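(* Let $m\ge2$. For a body $\Omega\subset\mathbb{R}^m$ with a piecewise $C^1$ boundary and $\alpha>0$ put $$E^{(\alpha)}(\Omega)=\int_{\Omega\times\Omega}|x-y|^{\alpha-m}\,d\mu(x)\,d\mu(y).$$ Among bodies with the same volume, balls attain the maximum of $E^{(\alpha)}(\Omega)$ when $0<\alpha<m$ and the minimum of $E^{(\alpha)}(\Omega)$ when $\alpha>m$.
   Context: A body is a compact subset of $\mathbb{R}^m$ that is the closure of its interior; all bodies are assumed to have piecewise $C^1$ boundary. $\mu$ is Lebesgue measure on $\mathbb{R}^m$. *)

(* Defs.v *)
From HB Require Import structures.
From mathcomp Require Import all_boot all_order all_algebra.
From mathcomp Require Import all_classical all_reals all_analysis.

Set Implicit Arguments.
Unset Strict Implicit.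
Unset Printing Implicit Defensive.

Import Order.TTheory GRing.Theory Num.Theory.
Import numFieldNormedType.Exports.

Local Open Scope classical_set_scope.
Local Open Scope ring_scope.

Definition rV_display : measure_display. Proof. exact: default_measure_display. Qed.

Section borel_rV.
Context {R : realType} {n : nat}.

Let borel : set (set 'rV[R]_n) := <<s open >>.

Let borel0 : borel set0. Proof. exact: sigma_algebra0. Qed.

Let borelC A : borel A -> borel (~` A). Proof. exact: sigma_algebraC. Qed.

Let borelU (F : (set 'rV[R]_n)^nat) :
  (forall i, borel (F i)) -> borel (\bigcup_i F i).
Proof. exact: sigma_algebra_bigcup. Qed.

HB.instance Definition _ :=
  @isMeasurable.Build rV_display 'rV[R]_n borel borel0 borelC borelU.

End borel_rV.

Definition cons_rV {R : realType} {n : nat} (p : R * 'rV[R]_n) : 'rV[R]_n.+1 :=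
  row_mx (const_mx p.1 : 'rV_1) p.2.

Definition uncons_rV {R : realType} {n : nat} (v : 'rV[R]_n.+1) : R * 'rV[R]_n :=
  (v ord0 ord0, rsubmx (v : 'rV_(1 + n))).

Lemma cons_rVK {R : realType} {n : nat} :
  cancel (@cons_rV R n) (@uncons_rV R n).
Proof.
case=> x v; rewrite /uncons_rV /cons_rV row_mxKr; congr pair.
by rewrite mxE; case: splitP => // j; rewrite mxE.
Qed.

Section measurable_rV.
Context {R : realType}.

Lemma open_measurable_rV n (U : set 'rV[R]_n) : open U -> measurable U.
Proof. exact: sub_sigma_algebra. Qed.

Lemma rat_ball_cover n (U : set 'rV[R]_n) : open U ->
  U = \bigcup_(c in [set c : 'rV[rat]_n * rat |
        0 < c.2 /\ ball (map_mx ratr c.1 : 'rV[R]_n) (ratr c.2) `<=` U])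
      ball (map_mx ratr c.1 : 'rV[R]_n) (ratr c.2).
Proof.
move=> oU; apply/seteqP; split; last by move=> x [c [_ cU]] /cU.
move=> x Ux; have : nbhs x U by exact: open_nbhs_nbhs.
move=> /nbhs_ballP[e /= e0 eU].
have [q] : exists q : rat, ratr q \in `]0, (e / 2)[.
  by apply: rat_in_itvoo; rewrite divr_gt0.
rewrite in_itv/= => /andP[q0 qe].
have rc i : exists r : rat, ratr r \in `](x ord0 i - ratr q), (x ord0 i)[.
  by apply: rat_in_itvoo; rewrite ltrBlDr ltrDl.
pose c : 'rV[rat]_n := \row_i projT1 (cid (rc i)).
have xc : ball (map_mx ratr c : 'rV[R]_n) (ratr q) x.
  split=> // i j; rewrite (ord1 i) !mxE; case: (cid _) => r /=.
  rewrite in_itv/= => /andP[r1 r2].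
  rewrite /ball/= ltr_distlC; apply/andP; split.
    by rewrite (lt_trans _ r2)// ltrBlDr ltrDl.
  by rewrite -ltrBlDr.
exists (c, q) => //=; split; first by rewrite -(ltr0q R).
apply: subset_trans eU => y cy; rewrite (splitr e).
have := ball_triangle (ball_sym xc) cy; apply: le_ball.
by rewrite lerD// ltW.
Qed.

Lemma measurable_coord_rV n (i : 'I_n) :
  measurable_fun setT (fun v : 'rV[R]_n => v ord0 i : measurableTypeR R).
Proof.
apply: (measurability _ (measurable_realfun.RGenOpens.measurableE R)).
move=> _ [_ [a [b ->] <-]]; rewrite setTI; apply: open_measurable_rV.
move/continuousP: (@coord_continuous R 1 n ord0 i); apply.
exact: interval_open.
Qed.

Lemma measurable_fun_rV d (T : measurableType d) n (f : T -> 'rV[R]_n) :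
  (forall i, measurable_fun setT (fun x => f x ord0 i : R)) ->
  measurable_fun setT f.
Proof.
move=> mf; apply: (measurability _ (erefl (@measurable _ (g_sigma_algebraType (@open 'rV[R]_n))))) => // _ [U oU <-]; rewrite setTI.
rewrite (rat_ball_cover oU) preimage_bigcup.
rewrite bigcup_mkcond; apply: countable_bigcupT_measurable => // -[c q].
case: ifPn => // _; rewrite /=.
have [q0|q0] := ltP 0 (ratr q : R); last first.
  rewrite (_ : _ @^-1` _ = set0)//; apply/seteqP; split => // x [].
  by rewrite ltNge q0.
rewrite (_ : _ @^-1` _ =
  \bigcap_(i in [set: 'I_n])
    ((fun x => f x ord0 i : R) @^-1` ball (ratr (c ord0 i) : R) (ratr q))).
  apply: fin_bigcap_measurable => // i _.
  by rewrite -[X in measurable X]setTI; apply: mf => //; apply: measurable_realfun.measurable_ball.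
apply/seteqP; split => x /=.
  by move=> [_ H] i _; have := H ord0 i; rewrite !mxE.
by move=> H; split=> // i j; rewrite (ord1 i) !mxE; exact: H.
Qed.

Lemma measurable_cons_rV n :
  measurable_fun setT (cons_rV : measurableTypeR R * 'rV[R]_n -> 'rV[R]_n.+1).
Proof.
apply: measurable_fun_rV => i.
have [j ->|j ->] := @split_ordP 1 n i.
  rewrite (_ : (fun _ => _) = fst)//; apply/funext => p.
  by rewrite /cons_rV; apply: etrans (row_mxEl _ _ _ _) _; rewrite mxE.
rewrite (_ : (fun _ => _) = (fun v : 'rV[R]_n => v ord0 j : R) \o snd); last first.
  by apply/funext => p; exact: row_mxEr.
by apply: measurableT_comp => //; exact: measurable_coord_rV.
Qed.

Lemma measurable_uncons_rV n :
  measurable_fun setT (uncons_rV : 'rV[R]_n.+1 -> measurableTypeR R * 'rV[R]_n).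
Proof.
apply: measurable_fun_pair; first exact: measurable_coord_rV.
apply: measurable_fun_rV => i.
rewrite (_ : (fun _ => _) = (fun v : 'rV[R]_n.+1 => v ord0 (lift ord0 i)));
    last first.
  by apply/funext => v /=; rewrite mxE; congr (v _ _); exact: val_inj.
exact: measurable_coord_rV.
Qed.

End measurable_rV.

Section lebesgue_rVS.
Context {R : realType} {n : nat}.
Variable mu : {sigma_finite_measure set 'rV[R]_n -> \bar R}.

Definition lebesgue_rVS : set 'rV[R]_n.+1 -> \bar R :=
  pushforward (lebesgue_measure \x mu)%E
    (cons_rV : measurableTypeR R * 'rV[R]_n -> 'rV[R]_n.+1).

Let nu : {measure set 'rV[R]_n.+1 -> \bar R} :=
  measure_function_pushforward__canonical__measure_function_Measure
    (lebesgue_measure \x mu)%E (measurable_cons_rV (n := n)).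

HB.instance Definition _ := isMeasure.Build _ _ _ lebesgue_rVS
  (measure0 nu) (measure_ge0 nu) (@measure_semi_sigma_additive _ _ _ nu).

Let sigma_finite_lebesgue_rVS : sigma_finite setT lebesgue_rVS.
Proof.
have /sigma_finiteP[F [TF ndF Foo]] := sigma_finiteT (@lebesgue_measure R).
have /sigma_finiteP[G [TG ndG Goo]] := sigma_finiteT mu.
exists (fun i => uncons_rV @^-1` (F i `*` G i)).
  rewrite -preimage_bigcup; apply/seteqP; split => // v _.
  have [i _ Fi] : (\bigcup_i F i) (uncons_rV v).1 by rewrite -TF.
  have [j _ Gj] : (\bigcup_i G i) (uncons_rV v).2 by rewrite -TG.
  exists (maxn i j) => //; split.
    by move: Fi; exact/subsetPset/ndF/leq_maxl.
  by move: Gj; exact/subsetPset/ndG/leq_maxr.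
move=> i; have [mF Foi] := Foo i; have [mG Goi] := Goo i; split.
  rewrite -[X in measurable X]setTI; apply: measurable_uncons_rV => //.
  exact: measurableX.
rewrite /lebesgue_rVS /pushforward -comp_preimage.
rewrite (_ : uncons_rV \o cons_rV = id); last first.
  by apply/funext => p /=; exact: cons_rVK.
by rewrite preimage_id product_measure1E// lte_mul_pinfty// ge0_fin_numE.
Qed.

HB.instance Definition _ := @Measure_isSigmaFinite.Build _ _ _ lebesgue_rVS
  sigma_finite_lebesgue_rVS.

End lebesgue_rVS.

(* Lebesgue measure on R^n: the n-fold product of Lebesgue measure on R,
   transported along R * R^n = R^(n+1); on R^0 it is the unit point mass. *)
Fixpoint lebesgue_rV (R : realType) (n : nat) :
    {sigma_finite_measure set 'rV[R]_n -> \bar R} :=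
  match n with
  | 0 => \d_(0 : 'rV[R]_0)
  | n'.+1 => lebesgue_rVS (lebesgue_rV R n')
  end.

Section bodies.
Context {R : realType}.

(* The Euclidean norm; the library's norm on 'rV[R]_n is the sup norm, which
   induces the same topology. *)
Definition enorm n (x : 'rV[R]_n) : R := Num.sqrt (\sum_i x ord0 i ^+ 2).

Definition eclosed_ball n (c : 'rV[R]_n) (r : R) : set 'rV[R]_n :=
  [set x | enorm (x - c) <= r].

Definition frontier n (A : set 'rV[R]_n) : set 'rV[R]_n := closure A `\` A°.

Definition closed_cube n : set 'rV[R]_n := [set u | forall i, 0 <= u ord0 i <= 1].

Definition open_cube n : set 'rV[R]_n := [set u | forall i, 0 < u ord0 i < 1].

Definition C1_near k n (A : set 'rV[R]_k) (phi : 'rV[R]_k -> 'rV[R]_n) :=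
  exists2 U : set 'rV[R]_k, open U /\ A `<=` U &
    forall u, U u ->
      differentiable phi u /\ {for u, continuous (jacobian phi)}.

(* A C^1 parametrised hypersurface piece: the image of the closed
   (n-1)-dimensional cube by a map that is C^1 up to the boundary of the cube,
   and injective and immersive in its interior. The map may degenerate on the
   boundary of the cube, so that curved triangles, cusps and cones are
   allowed as pieces. *)
Definition C1_patch n (phi : 'rV[R]_n.-1 -> 'rV[R]_n) :=
  [/\ C1_near (closed_cube (n := n.-1)) phi,
      set_inj (open_cube (n := n.-1)) phi &
      forall u, open_cube u -> row_free (jacobian phi u)].

Definition piecewise_C1_frontier n (A : set 'rV[R]_n) :=
  exists (N : nat) (phi : 'I_N -> 'rV[R]_n.-1 -> 'rV[R]_n),
    [/\ forall i, C1_patch (phi i),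
        frontier A = \bigcup_(i in [set: 'I_N]) (phi i @` closed_cube (n := n.-1)) &
        forall i j, i != j ->
          phi i @` open_cube (n := n.-1) `&` phi j @` open_cube (n := n.-1) = set0].

Definition body n (A : set 'rV[R]_n) :=
  [/\ compact A, closure (A°) = A & piecewise_C1_frontier A].

(* As 0 `^ s = 0 for s < 0, the integrand vanishes on the diagonal when
   alpha < n; the diagonal is negligible. *)
Definition riesz_energy n (alpha : R) (A : set 'rV[R]_n) : \bar R :=
  (\int[lebesgue_rV R n \x lebesgue_rV R n]_(p in A `*` A)
    (enorm (p.1 - p.2) `^ (alpha - n%:R))%:E)%E.

Definition bodies_of_volume n (v : \bar R) : set (set 'rV[R]_n) :=
  [set A | body A /\ lebesgue_rV R n A = v].

End bodies.

Definition attains_max (R : realType) (T : Type) (C : set T) (f : T -> \bar R)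
    (x : T) :=
  C x /\ forall y, C y -> (f y <= f x)%E.

Definition attains_min (R : realType) (T : Type) (C : set T) (f : T -> \bar R)
    (x : T) :=
  C x /\ forall y, C y -> (f x <= f y)%E.

(* Main.v *)
Require Import Defs.
From HB Require Import structures.
From mathcomp Require Import all_boot all_order all_algebra.
From mathcomp Require Import all_classical all_reals all_analysis.
From mathcomp Require Import measurable_realfun.
From mathcomp Require Import ring lra.
Import Order.TTheory GRing.Theory Num.Theory.
Import numFieldNormedType.Exports.
Local Open Scope classical_set_scope.
Local Open Scope ring_scope.
Set Implicit Arguments.
Unset Strict Implicit.
Unset Printing Implicit Defensive.

(** Both extremal statements reduce to one rearrangement inequality: if [f] is
nonincreasing on the nonnegative reals and takes values between 0 and [M],
and if a bounded measurable set [A] has the volume of the ball [B],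
then the double integral of [f |x - y|] over [A * A] is at most the one over
[B * B] ([riesz_le_eclosed_ball]).

- For [alpha < m] the kernel [t ^ (alpha - m)] is the supremum of its
  truncations at small distances, which are bounded and nonincreasing. Monotone
  convergence gives the inequality for the energy ([riesz_energy_le_ball]); on
  the diagonal the truncations do not vanish whereas the energy kernel does, but
  the diagonal is a null set.
- For [m < alpha] the kernel is bounded on bounded sets, and [d ^ (alpha - m)]
  minus the kernel is nonincreasing. Sets of equal volume give the same integral
  to the constant, so the inequality is reversed ([riesz_energy_ge_ball]).

The rearrangement inequality is proved by polarization. Let a hyperplane be given
and call near the half-space that contains the centre of [B]. For
every pair of points exchanged by the reflection, of which exactly one lies in
[A], polarization puts that one in the near half-space. This
preserves the volume ([lebesgue_polarize]), does not decrease the double integral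
([riesz_polarize]), by a comparison of four values of the kernel, and brings
[A] closer to [B]: the volume of [A \ B] decreases at least by the volume of the
set of points of [B \ A] whose mirror image lies in [A \ B]
([lebesgue_polarize_setD]).

No compactness argument is needed to reach the ball, because the gain is uniform:
if [A \ B] and [B \ A] have volume at least [delta], then some reflection has a
gain at least [g], where [g > 0] depends only on [delta] and on a ball that
contains all the sets ([reflection_overlap]). This comes from averaging over all
reflections. Finitely many polarizations therefore bring the volume of [A \ B]
below any [delta] ([exists_admissible]), and the double integral of a bounded
kernel is continuous with respect to that volume ([riesz_le_setD]).

All this uses the invariance of Lebesgue measure under reflections. For an
additive bijection [rho], shears of the product space show that
[vol (rho^-1 A) * vol B] and [vol (rho^-1 B) * vol A] agree
([additive_preimage]); taking for [B] a ball fixed by a linear reflection, or a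
cube in the case of a homothety, gives the factor.

Finally a ball is itself a body of the kind considered: its frontier is covered
by the central projections of the faces of a cube ([eclosed_ball_body]), and its
radius can be adjusted to any volume ([exists_ball_of_volume]). *)

(** * Measure-preserving maps *)

Section preserving.
Context d (T : measurableType d) (R : realType).
Implicit Types (m : {measure set T -> \bar R}) (f g : T -> T).

Definition preserving m f :=
  measurable_fun setT f /\
  forall A, measurable A -> m (f @^-1` A) = m A.

Lemma preimage_measurable d' (T' : measurableType d') (f : T -> T') A :
  measurable_fun setT f -> measurable A -> measurable (f @^-1` A).
Proof. by move=> mf mA; rewrite -[X in measurable X]setTI; exact: mf. Qed.

Lemma preserving_comp m f g :
  preserving m f -> preserving m g -> preserving m (g \o f).
Proof.
move=> [mf Pf] [mg Pg]; split; first exact: measurableT_comp.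
by move=> A mA; rewrite comp_preimage Pf ?Pg//; exact: preimage_measurable.
Qed.

Lemma preserving_integral m f (h : T -> \bar R) :
  preserving m f -> measurable_fun setT h -> (forall x, 0 <= h x)%E ->
  (\int[m]_x h (f x) = \int[m]_x h x)%E.
Proof.
move=> [mf Pf] mh h0.
pose m' := measure_function_pushforward__canonical__measure_function_Measure
  m mf.
transitivity (\int[m']_x h x)%E; last first.
  by apply: eq_measure_integral => A mA _; rewrite /= /pushforward Pf.
by rewrite [RHS]ge0_integral_pushforward.
Qed.

End preserving.

Section preserving_prod.
Context d1 d2 (T1 : measurableType d1) (T2 : measurableType d2) (R : realType).
Variables (m1 : {sigma_finite_measure set T1 -> \bar R})
  (m2 : {sigma_finite_measure set T2 -> \bar R}).

Lemma measurable_prod_map f g :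
  measurable_fun setT (f : T1 -> T1) -> measurable_fun setT (g : T2 -> T2) ->
  measurable_fun setT (fun p : T1 * T2 => (f p.1, g p.2)).
Proof.
by move=> mf mg; apply: measurable_fun_pair; exact: measurableT_comp.
Qed.

Lemma preserving_pair f g : preserving m1 f -> preserving m2 g ->
  preserving (m1 \x m2)%E (fun p => (f p.1, g p.2)).
Proof.
move=> [mf Pf] [mg Pg]; have mfg := measurable_prod_map mf mg.
split=> // A mA.
pose m' := measure_function_pushforward__canonical__measure_function_Measure
  (m1 \x m2)%E mfg.
apply/esym; apply: (@product_measure_unique _ _ _ _ _ _ _ m') => // X Y mX mY.
rewrite /= /pushforward -(Pf _ mX) -(Pg _ mY) -product_measure1E//;
  exact: preimage_measurable.
Qed.

(** By Tonelli's theorem, since a shear acts on each fibre by a measure-preserving map. *)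
Lemma preserving_shear (s : T1 -> T2 -> T2) :
  measurable_fun setT (fun p : T1 * T2 => (p.1, s p.1 p.2)) ->
  (forall x, preserving m2 (s x)) ->
  preserving (m1 \x m2)%E (fun p => (p.1, s p.1 p.2)).
Proof.
move=> ms Ps; split=> // A mA.
rewrite /product_measure1; apply: eq_integral => x _ /=.
rewrite -(proj2 (Ps x) (xsection A x)); last exact: measurable_xsection.
by congr (m2 _); apply/seteqP; split => y /=; rewrite /xsection/= !inE.
Qed.

End preserving_prod.

Lemma preserving_swap d (T : measurableType d) (R : realType)
    (m : {sigma_finite_measure set T -> \bar R}) :
  preserving (m \x m)%E (fun p : T * T => (p.2, p.1)).
Proof.
have ms : measurable_fun setT (fun p : T * T => (p.2, p.1)).
  exact: measurable_fun_pair.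
split => // A mA.
pose m' := measure_function_pushforward__canonical__measure_function_Measure
  (m \x m)%E ms.
apply/esym; apply: (@product_measure_unique _ _ _ _ _ _ _ m') => // X Y mX mY.
rewrite /= /pushforward muleC -product_measure1E//.
by congr (product_measure1 _ _ _); apply/seteqP; split => -[x y] /= [].
Qed.

(** * Translations *)

Lemma preserving_shift1 (R : realType) (t : R) :
  preserving (@lebesgue_measure R) (fun x : measurableTypeR R => x + t : measurableTypeR R).
Proof.
have mt : measurable_fun setT (fun x : measurableTypeR R => x + t : measurableTypeR R).
  exact: measurable_funD.
split => // A mA.
pose m' := measure_function_pushforward__canonical__measure_function_Measure
  (@lebesgue_measure R) mt.
apply/esym/(@lebesgue_measure_unique _ m') => // _ [[a b]] _ <-.
rewrite /= /pushforward (_ : _ @^-1` _ = `]a - t, b - t]%classic).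
  rewrite !lebesgue_measure_itv/= !lte_fin ltrD2r.
  by case: ifPn => // _; rewrite -!EFinD; congr EFin; ring.
by apply/seteqP; split => x /=; rewrite !in_itv/= ltrBlDr lerBrDr.
Qed.

Section rV.
Context {R : realType}.
Local Notation L n := (lebesgue_rV R n).

Lemma measurable_addrV n d (T : measurableType d) (f g : T -> 'rV[R]_n) :
  measurable_fun setT f -> measurable_fun setT g ->
  measurable_fun setT (fun x => f x + g x).
Proof.
move=> mf mg; apply: measurable_fun_rV => i.
under eq_fun do rewrite mxE.
by apply: measurable_funD; apply: (measurableT_comp (measurable_coord_rV i)).
Qed.

Lemma measurable_opprV n d (T : measurableType d) (f : T -> 'rV[R]_n) :
  measurable_fun setT f -> measurable_fun setT (fun x => - f x).
Proof.
move=> mf; apply: measurable_fun_rV => i.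
under eq_fun do rewrite mxE.
by apply: measurableT_comp => //; apply: (measurableT_comp (measurable_coord_rV i)).
Qed.

Lemma measurable_subrV n d (T : measurableType d) (f g : T -> 'rV[R]_n) :
  measurable_fun setT f -> measurable_fun setT g ->
  measurable_fun setT (fun x => f x - g x).
Proof.
by move=> mf mg; apply: measurable_addrV => //; exact: measurable_opprV.
Qed.

Lemma measurable_scalerV n d (T : measurableType d) (k : T -> R)
    (f : T -> 'rV[R]_n) :
  measurable_fun setT k -> measurable_fun setT f ->
  measurable_fun setT (fun x => k x *: f x).
Proof.
move=> mk mf; apply: measurable_fun_rV => i.
under eq_fun do rewrite mxE.
by apply: measurable_funM => //; apply: (measurableT_comp (measurable_coord_rV i)).
Qed.

(** Under the identification of the space with a product with a line, a
    translation is a product of translations. *)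
Lemma preserving_shift n (t : 'rV[R]_n) : preserving (L n) (fun x => x + t).
Proof.
elim: n t => [|n IHn] t.
  rewrite (_ : (fun _ => _) = id); first by split => //; exact: measurable_id.
  by apply/funext => x; rewrite !thinmx0.
have mt : measurable_fun setT (fun x : 'rV[R]_n.+1 => x + t).
  by apply: measurable_addrV => //; exact: measurable_cst.
split=> // A mA; rewrite /= /lebesgue_rVS /pushforward.
pose f (x : measurableTypeR R) := x + (uncons_rV t).1 : measurableTypeR R.
pose g (x : 'rV[R]_n) := x + (uncons_rV t).2.
have mC : measurable ((cons_rV : measurableTypeR R * 'rV[R]_n -> _) @^-1` A).
  by apply: preimage_measurable => //; exact: measurable_cons_rV.
have [_ Pfg] := preserving_pair (preserving_shift1 (uncons_rV t).1)
  (IHn (uncons_rV t).2).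
have fgE p : cons_rV p + t =
    cons_rV (p.1 + (uncons_rV t).1, p.2 + (uncons_rV t).2).
  case: p => x v /=; apply/rowP => i; rewrite !mxE.
  have [j ij|j ij] := @split_ordP 1 n i; rewrite !mxE.
    by congr (_ + t _ _); apply/val_inj; rewrite ij/= (ord1 j).
  by congr (_ + t _ _); apply/val_inj; rewrite ij.
rewrite -[RHS](Pfg _ mC); congr (product_measure1 _ _ _).
by apply/seteqP; split => p; rewrite /preimage/= fgE.
Qed.

End rV.

(** * The Euclidean inner product *)

Section dot.
Context {R : realType} {n : nat}.
Implicit Types x y z w : 'rV[R]_n.

Definition dot x y : R := \sum_i x ord0 i * y ord0 i.

Definition sqn x : R := dot x x.

Lemma dotC x y : dot x y = dot y x.
Proof. by apply: eq_bigr => i _; rewrite mulrC. Qed.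

Lemma dotDl x y z : dot (x + y) z = dot x z + dot y z.
Proof. by rewrite -big_split; apply: eq_bigr => i _; rewrite mxE mulrDl. Qed.

Lemma dotZl k x y : dot (k *: x) y = k * dot x y.
Proof. by rewrite mulr_sumr; apply: eq_bigr => i _; rewrite mxE mulrA. Qed.

Lemma dotNl x y : dot (- x) y = - dot x y.
Proof. by rewrite -scaleN1r dotZl mulN1r. Qed.

Lemma dotDr x y z : dot x (y + z) = dot x y + dot x z.
Proof. by rewrite dotC dotDl !(dotC x). Qed.

Lemma dotZr k x y : dot x (k *: y) = k * dot x y.
Proof. by rewrite dotC dotZl dotC. Qed.

Lemma dotNr x y : dot x (- y) = - dot x y.
Proof. by rewrite dotC dotNl dotC. Qed.

Definition dotE := (dotDl, dotDr, dotNl, dotNr, dotZl, dotZr).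

Lemma sqn_ge0 x : 0 <= sqn x.
Proof. by apply: sumr_ge0 => i _; rewrite -expr2 sqr_ge0. Qed.

Lemma sqr_coord_le_sqn x i : x ord0 i ^+ 2 <= sqn x.
Proof.
rewrite /sqn /dot (bigD1 i)//= -expr2 lerDl.
by apply: sumr_ge0 => j _; rewrite -expr2 sqr_ge0.
Qed.

Lemma sqn_eq0 x : sqn x = 0 -> x = 0.
Proof.
move=> x0; apply/rowP => i; rewrite mxE; apply/eqP; rewrite -sqrf_eq0.
by rewrite eq_le sqr_ge0 andbT -x0 sqr_coord_le_sqn.
Qed.

Lemma sqn0 : sqn 0 = 0.
Proof. by rewrite /sqn /dot big1// => i _; rewrite mxE mul0r. Qed.

Lemma sqnZ k x : sqn (k *: x) = k ^+ 2 * sqn x.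
Proof. by rewrite /sqn !dotE mulrA expr2. Qed.

Lemma sqnN x : sqn (- x) = sqn x.
Proof. by rewrite /sqn !dotE opprK. Qed.

Lemma sqnBC x y : sqn (x - y) = sqn (y - x).
Proof. by rewrite -sqnN opprB. Qed.

Lemma sqnD x y : sqn (x + y) = sqn x + 2 * dot x y + sqn y.
Proof. by rewrite /sqn !dotE (dotC y x); ring. Qed.

Lemma dot_le_sqn x y : `|2 * dot x y| <= sqn x + sqn y.
Proof.
rewrite ler_norml; apply/andP; split.
  by have := sqn_ge0 (x + y); rewrite sqnD; lra.
have := sqn_ge0 (x - y).
by rewrite sqnD sqnN dotNr; lra.
Qed.

(** A substitute for the triangle inequality, which suffices for all the
    boundedness statements below. *)
Lemma sqn_le_double x y z : sqn (x - z) <= 2 * (sqn (x - y) + sqn (z - y)).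
Proof.
have -> : x - z = (x - y) + - (z - y) by rewrite opprB addrA subrK.
move: (x - y) (z - y) => a b.
have := dot_le_sqn a (- b); rewrite ler_norml => /andP[_].
by rewrite sqnD sqnN; lra.
Qed.

Lemma enormE x : enorm x = Num.sqrt (sqn x).
Proof. by congr Num.sqrt; apply: eq_bigr => i _; rewrite expr2. Qed.

Lemma enorm_ge0 x : 0 <= enorm x.
Proof. exact: sqrtr_ge0. Qed.

Lemma sqr_enorm x : enorm x ^+ 2 = sqn x.
Proof. by rewrite enormE sqr_sqrtr// sqn_ge0. Qed.

Lemma enorm_le x r : 0 <= r -> (enorm x <= r) = (sqn x <= r ^+ 2).
Proof. by move=> r0; rewrite -sqr_enorm ler_pXn2r// nnegrE// enorm_ge0. Qed.

Lemma enorm_le_sqn x y : (enorm x <= enorm y) = (sqn x <= sqn y).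
Proof. by rewrite enorm_le ?enorm_ge0// sqr_enorm. Qed.

Lemma enormZ k x : enorm (k *: x) = `|k| * enorm x.
Proof. by rewrite !enormE sqnZ sqrtrM ?sqr_ge0// sqrtr_sqr. Qed.

Lemma enorm_eq0 x : enorm x = 0 -> x = 0.
Proof. by move=> x0; apply: sqn_eq0; rewrite -sqr_enorm x0 expr0n. Qed.

Lemma enorm_gt0 x : x != 0 -> 0 < enorm x.
Proof.
by move=> x0; rewrite lt_def enorm_ge0 andbT; apply: contraNneq x0 => /enorm_eq0 ->.
Qed.

Lemma eclosed_ballE c r : 0 <= r ->
  eclosed_ball c r = [set x | sqn (x - c) <= r ^+ 2].
Proof. by move=> r0; apply/seteqP; split => x; rewrite /eclosed_ball/= enorm_le. Qed.

Lemma measurable_dot d (T : measurableType d) (f g : T -> 'rV[R]_n) :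
  measurable_fun setT f -> measurable_fun setT g ->
  measurable_fun setT (fun t => dot (f t) (g t)).
Proof.
move=> mf mg; apply: measurable_sum => i.
by apply: measurable_funM; apply: (measurableT_comp (measurable_coord_rV i)).
Qed.

Lemma measurable_enorm d (T : measurableType d) (f : T -> 'rV[R]_n) :
  measurable_fun setT f -> measurable_fun setT (fun t => enorm (f t)).
Proof.
move=> mf; rewrite (_ : (fun _ => _) = @Num.sqrt R \o (fun t => sqn (f t))).
  apply: measurableT_comp; last exact: measurable_dot.
  by apply: continuous_measurable_fun; exact: sqrt_continuous.
by apply/funext => t; rewrite enormE.
Qed.

End dot.

(** * Uniqueness of the invariant measure and its consequences *)

Section invariant_measure.
Context {R : realType} {n : nat}.
Local Notation L := (lebesgue_rV R n).
Local Notation V := 'rV[R]_n.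

Lemma preserving_shear_addr (h : V -> V) : measurable_fun setT h ->
  preserving (L \x L)%E (fun p : V * V => (p.1, p.2 + h p.1)).
Proof.
move=> mh; apply: (@preserving_shear _ _ _ _ _ L L (fun x y => y + h x)).
  apply: measurable_fun_pair => //.
  by apply: measurable_addrV => //; exact: measurableT_comp.
by move=> x; exact: preserving_shift.
Qed.

Lemma preserving_shear_addl (h : V -> V) : measurable_fun setT h ->
  preserving (L \x L)%E (fun p : V * V => (p.1 + h p.2, p.2)).
Proof.
move=> mh; have Psw := preserving_swap L.
exact: (preserving_comp (preserving_comp Psw (preserving_shear_addr mh)) Psw).
Qed.


(** On the product space, [rho^-1 A * B] is carried to [rho^-1 B * (- A)] by
    composing the shears [(x, y) |-> (x, y + rho x)],
    [(x, y) |-> (x - rho' y, y)] and again [(x, y) |-> (x, y + rho x)]. *)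
Lemma additive_preimage_exchange (rho rho' : V -> V) (A B : set V) :
  measurable_fun setT rho -> measurable_fun setT rho' ->
  {morph rho : x y / x + y} -> cancel rho' rho ->
  measurable A -> measurable B ->
  (L (rho @^-1` A) * L B =
   L (rho @^-1` B) * L ((fun x : V => (- x)%R) @^-1` A))%E.
Proof.
move=> mr mr' rD rK mA mB.
have mN : measurable_fun setT (fun x : V => - x).
  by apply: measurable_opprV; exact: measurable_id.
have rN x : rho (- x) = - rho x.
  have r0 : rho 0 = 0 by apply: (addrI (rho 0)); rewrite -rD !addr0.
  by apply: (addrI (rho x)); rewrite -rD !subrr.
have mrA := preimage_measurable mr mA.
have mrB := preimage_measurable mr mB.
rewrite -!product_measure1E//; last exact: preimage_measurable.
have [m1 P1] := preserving_shear_addr mr.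
have [m2 P2] : preserving (L \x L)%E (fun p : V * V => ((p.1 - rho' p.2)%R, p.2)).
  by exact: (@preserving_shear_addl (fun x => - rho' x) (measurable_opprV mr')).
have mS0 : measurable ((rho @^-1` A) `*` B) by exact: measurableX.
have mS1 := preimage_measurable m1 mS0.
have mS2 := preimage_measurable m2 mS1.
rewrite -(P1 _ mS0) -(P2 _ mS1) -(P1 _ mS2); congr (product_measure1 _ _ _).
have E p : rho (p.1 - rho' (p.2 + rho p.1)) = - p.2.
  by rewrite rD rN rK opprD addrCA subrr addr0.
have E' p : p.2 + rho p.1 - p.2 = rho p.1 by rewrite addrAC subrr add0r.
by apply/seteqP; split => p; rewrite /preimage /= E E' => -[].
Qed.

End invariant_measure.

Definition box {R : realType} n (a : 'rV[R]_n) (k : R) : set 'rV[R]_n :=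
  [set x | forall i, a ord0 i <= x ord0 i <= a ord0 i + k].

Section volumes.
Context {R : realType}.
Local Notation L n := (lebesgue_rV R n).

Lemma cons_rV_ord0 n (p : R * 'rV[R]_n) : cons_rV p ord0 ord0 = p.1.
Proof. exact: (congr1 fst (cons_rVK p)). Qed.

Lemma cons_rV_rshift n (p : R * 'rV[R]_n) i :
  cons_rV p ord0 (rshift 1 i) = p.2 ord0 i.
Proof. exact: row_mxEr. Qed.

Lemma measurable_box n (a : 'rV[R]_n) k : measurable (box a k).
Proof.
rewrite (_ : box a k = \bigcap_(i in [set: 'I_n])
    ((fun x => x ord0 i : R) @^-1` `[a ord0 i, a ord0 i + k]%classic)).
  apply: fin_bigcap_measurable => // i _.
  by apply: (preimage_measurable (measurable_coord_rV i)) => //; exact: measurable_itv.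
apply/seteqP; split => x /=.
  by move=> H i _ /=; rewrite in_itv/=; exact: H.
by move=> H i; have := H i Logic.I; rewrite /= in_itv.
Qed.

Lemma lebesgue_box n (a : 'rV[R]_n) k : 0 <= k -> L n (box a k) = (k ^+ n)%:E.
Proof.
move=> k0; elim: n a => [|n IHn] a.
  by rewrite /= diracE expr0 mem_set// => -[].
rewrite /= /lebesgue_rVS /pushforward.
rewrite (_ : _ @^-1` _ = `[a ord0 ord0, a ord0 ord0 + k]%classic `*`
    box (uncons_rV a).2 k).
  rewrite product_measure1E//; last exact: measurable_box.
  rewrite [RHS](_ : _ = k%:E * (k ^+ n)%:E)%E; last by rewrite exprS EFinM.
  congr (_ * _)%E; last exact: IHn.
  apply: etrans (lebesgue_measure_itv _) _; rewrite /= lte_fin ltrDl.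
  have [k1|] := ltP 0 k; first by rewrite -EFinB addrC addKr.
  by rewrite le_eqVlt ltNge k0 orbF => /eqP ->.
have aE i : a ord0 (rshift 1 i) = (uncons_rV a).2 ord0 i by rewrite mxE.
apply/seteqP; split => -[x v] /=.
  move=> H; split; rewrite /= ?in_itv/=.
    by have := H ord0; rewrite cons_rV_ord0.
  move=> i; have := H (rshift 1 i); rewrite aE.
  by rewrite cons_rV_rshift.
move=> [] /=; rewrite in_itv/= => Hx Hv i.
have [j ->|j ->] := @split_ordP 1 n i.
  rewrite (_ : lshift n j = ord0); last by apply: val_inj; rewrite /= (ord1 j).
  by rewrite cons_rV_ord0.
by rewrite aE cons_rV_rshift.
Qed.

End volumes.

Section linear_invariance.
Context {R : realType} {n : nat}.
Local Notation L := (lebesgue_rV R n).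
Local Notation V := 'rV[R]_n.

(** The exchange identity for [rho = id], tested on a cube of volume 1. *)
Lemma lebesgue_opp (A : set V) : measurable A ->
  L ((fun x : V => - x) @^-1` A) = L A.
Proof.
move=> mA; have mid : measurable_fun setT (@id V) by exact: measurable_id.
have := @additive_preimage_exchange R n id id A (box 0 1) mid mid
  (fun _ _ => erefl) (fun _ => erefl) mA (measurable_box _ _).
by rewrite !preimage_id lebesgue_box// expr1n mule1 mul1e.
Qed.

(** The ratio [vol (rho^-1 A) / vol A] does not depend on [A]: this is the
    uniqueness of the translation-invariant measure, stated without division. *)
Lemma additive_preimage (rho rho' : V -> V) (A B : set V) :
  measurable_fun setT rho -> measurable_fun setT rho' ->
  {morph rho : x y / x + y} -> cancel rho' rho ->
  measurable A -> measurable B ->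
  (L (rho @^-1` A) * L B = L (rho @^-1` B) * L A)%E.
Proof.
move=> mr mr' rD rK mA mB.
by rewrite (additive_preimage_exchange mr mr' rD rK mA mB) lebesgue_opp.
Qed.

(** A homothety maps cubes to cubes, which determines its factor. *)
Lemma lebesgue_scale (k : R) (A : set V) : 0 < k -> measurable A ->
  L ((fun x : V => k *: x) @^-1` A) = ((k ^- n)%:E * L A)%E.
Proof.
move=> k0 mA.
have mk (c : R) : measurable_fun setT (fun x : V => c *: x).
  by apply: measurable_scalerV => //; exact: measurable_id.
have := @additive_preimage (fun x => k *: x) (fun x => k^-1 *: x) A (box 0 1)
  (mk _) (mk _) (scalerDr k) (fun x => _) mA (measurable_box _ _).
rewrite lebesgue_box// expr1n mule1 => -> //.
  rewrite (_ : _ @^-1` _ = box 0 k^-1).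
    by rewrite lebesgue_box ?invr_ge0 ?ltW// exprVn.
  apply/seteqP; split => x H i; have := H i; rewrite !mxE !add0r.
    by rewrite pmulr_rge0// -ler_pdivlMl// mulr1.
  by rewrite pmulr_rge0// -[X in _ -> _ && X]ler_pdivlMl// mulr1.
by move=> x; rewrite scalerA mulfV ?gt_eqF// scale1r.
Qed.

End linear_invariance.

(** * Reflections preserve volume *)

Section unit_ball.
Context {R : realType} {n : nat}.
Local Notation L := (lebesgue_rV R n).

Lemma measurable_eclosed_ball (c : 'rV[R]_n) r : measurable (eclosed_ball c r).
Proof.
rewrite (_ : eclosed_ball c r = (fun x => enorm (x - c)) @^-1` `]-oo, r]%classic).
  apply: preimage_measurable; last exact: measurable_itv.
  apply: measurable_enorm; apply: measurable_subrV; last exact: measurable_cst.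
  exact: measurable_id.
by apply/seteqP; split => x; rewrite /= in_itv.
Qed.

Lemma eclosed_ball_sub_box (c : 'rV[R]_n) r : 0 <= r ->
  eclosed_ball c r `<=` box (c - const_mx r) (2 * r).
Proof.
move=> r0 x; rewrite eclosed_ballE//= => xc i; rewrite !mxE.
have := le_trans (sqr_coord_le_sqn (x - c) i) xc.
rewrite !mxE -[X in X <= _]real_normK ?num_real// ler_pXn2r ?nnegrE//.
by rewrite ler_norml => /andP[? ?]; apply/andP; split; lra.
Qed.

Lemma box_sub_eclosed_ball (c : 'rV[R]_n) r : 0 <= r ->
  box c (r / n.+1%:R) `<=` eclosed_ball c r.
Proof.
move=> r0 x xc; rewrite eclosed_ballE//=.
have rn0 : 0 <= r / n.+1%:R by rewrite divr_ge0.
have n1 : n%:R / n.+1%:R <= 1 :> R.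
  by rewrite ler_pdivrMr ?ltr0n// mul1r ler_nat.
have rnr : r / n.+1%:R <= r by rewrite ler_pdivrMr ?ltr0n// ler_peMr// ler1n.
apply: (@le_trans _ _ (\sum_(i < n) (r / n.+1%:R) * r)).
  apply: ler_sum => i _; have /andP[x1 x2] := xc i.
  rewrite !mxE; apply: ler_pM; rewrite ?subr_ge0//; rewrite lerBlDl//.
  by rewrite (le_trans x2)// lerD2l.
rewrite sumr_const card_ord -[_ *+ n]mulr_natl.
rewrite [leLHS](_ : _ = n%:R / n.+1%:R * r ^+ 2); last first.
  by rewrite expr2 -!mulrA; congr (_ * _); rewrite mulrCA.
by rewrite ler_piMl// sqr_ge0.
Qed.

Lemma lebesgue_eclosed_ball_lty (c : 'rV[R]_n) r : (L (eclosed_ball c r) < +oo)%E.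
Proof.
have [r0|r0] := leP 0 r.
  apply: (@le_lt_trans _ _ (L (box (c - const_mx r) (2 * r)))).
    apply: le_measure; rewrite ?inE; [exact: measurable_eclosed_ball|exact: measurable_box|].
    exact: eclosed_ball_sub_box.
  by rewrite lebesgue_box ?ltry// mulr_ge0.
rewrite (_ : eclosed_ball c r = set0) ?measure0//.
apply/seteqP; split => // x /= /le_lt_trans/(_ r0).
by rewrite ltNge enorm_ge0.
Qed.

Lemma lebesgue_eclosed_ball_gt0 (c : 'rV[R]_n) r : 0 < r ->
  (0 < L (eclosed_ball c r))%E.
Proof.
move=> r0; apply: (@lt_le_trans _ _ (L (box c (r / n.+1%:R)))).
  by rewrite lebesgue_box ?divr_ge0 ?ltW// lte_fin exprn_gt0// divr_gt0.
apply: le_measure; rewrite ?inE; [exact: measurable_box|exact: measurable_eclosed_ball|].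
by apply: box_sub_eclosed_ball; exact: ltW.
Qed.

Lemma lebesgue_bounded_lty (c : 'rV[R]_n) r (A : set 'rV[R]_n) :
  measurable A -> A `<=` eclosed_ball c r -> (L A < +oo)%E.
Proof.
move=> mA Ac; apply: le_lt_trans (lebesgue_eclosed_ball_lty c r).
by apply: le_measure; rewrite ?inE//; exact: measurable_eclosed_ball.
Qed.

Lemma lebesgue_bounded_fin_num (c : 'rV[R]_n) r (A : set 'rV[R]_n) :
  measurable A -> A `<=` eclosed_ball c r -> L A \is a fin_num.
Proof.
move=> mA Ac; rewrite ge0_fin_numE; first exact: (lebesgue_bounded_lty mA Ac).
exact: measure_ge0.
Qed.

End unit_ball.

Section reflection.
Context {R : realType} {n : nat}.
Local Notation L := (lebesgue_rV R n).
Local Notation V := 'rV[R]_n.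
Variables (c w : V) (k : R).
Implicit Types x y z : V.

(** The hyperplane with normal vector [w] whose nearest point to [c] is
    [c + (k / 2) *: w]; [side] is negative on the side of [c] when [0 < k]. This
    choice of the offset makes the reflection of [c] equal to [c + k *: w]. *)
Definition side z := 2 * dot (z - c) w - k * sqn w.

(** For [w = 0] the convention [x / 0 = 0] makes this the identity, so that the
    properties below hold for every [w]. *)
Definition refl z := z - (side z / sqn w) *: w.

Lemma side_refl z : side (refl z) = - side z.
Proof.
have [w0|w0] := eqVneq (sqn w) 0.
  have {w0} w0 : w = 0 by exact: sqn_eq0.
  have d0 y : dot y w = 0.
    by rewrite w0 /dot big1// => i _; rewrite mxE mulr0.
  by rewrite /side !d0 /sqn d0 !mulr0 subrr oppr0.
have sideB t : side (z - t *: w) = side z - 2 * t * sqn w.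
  by rewrite /side /sqn !dotE; ring.
by rewrite sideB; field.
Qed.

Lemma reflK : involutive refl.
Proof. by move=> z; rewrite {1}/refl side_refl mulNr scaleNr opprK subrK. Qed.

(** The distance from [x] to the mirror image of [y] exceeds the distance from
    [x] to [y] when [x] and [y] lie strictly on the same side. *)
Lemma sqn_refl x y : sqn (x - refl y) = sqn (x - y) + side x * side y / sqn w.
Proof.
have [w0|w0] := eqVneq (sqn w) 0.
  by rewrite /refl w0 invr0 !mulr0 scale0r subr0 addr0.
have -> : x - refl y = (x - y) + (side y / sqn w) *: w.
  by rewrite /refl opprB addrA addrAC.
rewrite sqnD sqnZ dotZr.
have -> : side x = 2 * dot (x - y) w + side y.
  by rewrite /side !dotE; ring.
by field.
Qed.

Lemma sqn_refl_refl x y : sqn (refl x - refl y) = sqn (x - y).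
Proof.
rewrite sqn_refl side_refl sqnBC sqn_refl sqnBC (mulrC (side y)).
by rewrite !mulNr addrK.
Qed.

Lemma side_eq0 z : side z = 0 -> refl z = z.
Proof. by move=> z0; rewrite /refl z0 mul0r scale0r subr0. Qed.

(** For [0 <= k] the centre [c] lies on the nonpositive side. *)
Lemma sqn_refl_center z : 0 <= k -> side z <= 0 ->
  sqn (z - c) <= sqn (refl z - c).
Proof.
move=> k0 z0; rewrite (sqnBC (refl z)) sqn_refl (sqnBC z) lerDl.
rewrite divr_ge0 ?sqn_ge0// mulr_le0// /side subrr /dot big1 ?mulr0 ?sub0r.
  by rewrite oppr_le0 mulr_ge0// sqn_ge0.
by move=> i _; rewrite mxE mul0r.
Qed.

Lemma measurable_refl : measurable_fun setT refl.
Proof.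
have mid : measurable_fun setT (fun x : V => x) by exact: measurable_id.
apply: measurable_subrV => //.
apply: measurable_scalerV; last exact: measurable_cst.
apply: measurable_funM => //; apply: measurable_funB => //.
apply: measurable_funM => //; apply: measurable_dot => //.
by apply: measurable_subrV.
Qed.

Lemma measurable_side : measurable_fun setT side.
Proof.
apply: measurable_funB => //; apply: measurable_funM => //.
by apply: measurable_dot => //; exact: measurable_subrV.
Qed.

End reflection.

Section reflection_invariance.
Context {R : realType} {n : nat}.
Local Notation L := (lebesgue_rV R n).
Local Notation V := 'rV[R]_n.

(** A linear reflection fixes the unit ball, so that its factor is 1. *)
Lemma preserving_refl0 (w : V) : preserving L (refl 0 w 0).
Proof.
have mr := measurable_refl (0 : V) w 0.
have sE z : side 0 w 0 z = 2 * dot z w by rewrite /side subr0 mul0r subr0.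
have rD : {morph refl 0 w 0 : x y / x + y}.
  move=> x y; rewrite /refl !sE dotDl mulrDr mulrDl scalerDl opprD.
  by rewrite !addrA; congr (_ + _); rewrite addrAC.
split => // A mA.
have := additive_preimage mr mr rD (reflK (0 : V) w 0) mA
  (measurable_eclosed_ball 0 1).
rewrite (_ : _ @^-1` eclosed_ball 0 1 = eclosed_ball 0 1).
  rewrite muleC => E.
  have B0 := lebesgue_eclosed_ball_gt0 (0 : V) (@ltr01 R).
  have Boo := lebesgue_eclosed_ball_lty (0 : V) (1 : R).
  have Bf : L (eclosed_ball 0 1) \is a fin_num by rewrite ge0_fin_numE// ltW.
  by apply/eqP; rewrite eq_le; apply/andP; split;
    rewrite -(lee_pmul2l Bf B0) E lexx.
have r0 : refl 0 w 0 0 = 0.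
  by rewrite side_eq0// sE /dot big1 ?mulr0// => i _; rewrite mxE mul0r.
have sq x : sqn (refl 0 w 0 x) = sqn x.
  by have := sqn_refl_refl 0 w 0 x 0; rewrite r0 !subr0.
by rewrite !eclosed_ballE//; apply/seteqP; split => x; rewrite /= !subr0 sq.
Qed.

Lemma preserving_refl (c w : V) (k : R) : preserving L (refl c w k).
Proof.
have -> : refl c w k = (fun z => z - (side c w k 0 / sqn w) *: w) \o refl 0 w 0.
  apply/funext => z /=; rewrite /refl -addrA -opprD -scalerDl -mulrDl.
  by congr (_ - (_ / _) *: _); rewrite /side !dotE; ring.
by apply: preserving_comp; [exact: preserving_refl0|exact: preserving_shift].
Qed.

End reflection_invariance.

(** * Polarization *)

Lemma lee_double (R : realDomainType) (a b : \bar R) :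
  (a + a <= b + b -> a <= b)%E.
Proof.
case: a b => [a||] [b||] //=; rewrite -?EFinD ?lee_fin ?leNye ?leey//.
  by lra.
Qed.

Lemma lebesgue_rV_indic (R : realType) n (A : set 'rV[R]_n) : measurable A ->
  lebesgue_rV R n A = (\int[lebesgue_rV R n]_x (\1_A x)%:E)%E.
Proof. by move=> mA; rewrite integral_indic// setIT. Qed.

Section symmetrize.
Context d (T : measurableType d) (R : realType).
Variables (m : {measure set T -> \bar R}) (tau : T -> T).
Hypothesis Ptau : preserving m tau.

Lemma integral_symmetrize (h : T -> \bar R) : measurable_fun setT h ->
  (forall x, 0 <= h x)%E ->
  (\int[m]_x (h x + h (tau x)) = \int[m]_x h x + \int[m]_x h x)%E.
Proof.
move=> mh h0; have [mt _] := Ptau.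
rewrite ge0_integralD//; last exact: measurableT_comp.
by congr (_ + _)%E; exact: preserving_integral.
Qed.

(** An inequality between integrals may be checked after symmetrization of the
    integrands under a measure-preserving map. *)
Lemma le_integral_symmetrize (f g : T -> \bar R) :
  measurable_fun setT f -> measurable_fun setT g ->
  (forall x, 0 <= f x)%E -> (forall x, 0 <= g x)%E ->
  (forall x, f x + f (tau x) <= g x + g (tau x))%E ->
  (\int[m]_x f x <= \int[m]_x g x)%E.
Proof.
move=> mf mg f0 g0 fg; have [mt _] := Ptau.
apply: lee_double; rewrite -!integral_symmetrize//.
apply: ge0_le_integral => //.
- by move=> x _; rewrite adde_ge0.
- by apply: emeasurable_funD => //; exact: measurableT_comp.
- by apply: emeasurable_funD => //; exact: measurableT_comp.
Qed.

End symmetrize.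

Section riesz.
Context {R : realType} {n : nat}.
Local Notation L := (lebesgue_rV R n).
Local Notation V := 'rV[R]_n.

Definition riesz (k : R -> R) (A : set V) : \bar R :=
  (\int[L \x L]_p (\1_A p.1 * \1_A p.2 * k (enorm (p.1 - p.2)))%:E)%E.

Lemma measurable_riesz (k : R -> R) (A B : set V) :
  measurable_fun setT k -> measurable A -> measurable B ->
  measurable_fun setT (fun p : V * V =>
    (\1_A p.1 * \1_B p.2 * k (enorm (p.1 - p.2)))%:E).
Proof.
move=> mk mA mB; apply/measurable_EFinP; apply: measurable_funM.
  apply: measurable_funM; apply: measurableT_comp => //; exact: measurable_indic.
apply: measurableT_comp => //; apply: measurable_enorm.
exact: measurable_subrV.
Qed.

End riesz.

Section polarization.
Context {R : realType} {n : nat}.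
Local Notation L := (lebesgue_rV R n).
Local Notation V := 'rV[R]_n.
Variables (c w : V) (k : R).
Local Notation side := (side c w k).
Local Notation refl := (refl c w k).
Implicit Types (A B : set V) (x y : V).

(** On a hyperplane point both cases agree, as [refl x = x] there. *)
Definition polarize A : set V :=
  [set x | side x <= 0 /\ (A x \/ A (refl x))] `|`
  [set x | 0 < side x /\ (A x /\ A (refl x))].

Lemma polarize_neg A x : side x <= 0 ->
  ((x \in polarize A) = (x \in A) || (refl x \in A)) *
  ((refl x \in polarize A) = (x \in A) && (refl x \in A)).
Proof.
move=> x0; have sE := side_refl c w k x.
split; apply/idP/idP; rewrite ?inE /polarize/=.
- case=> [[_ [Ax|Ax]]|[]]; last by rewrite ltNge x0.
    by apply/orP; left; rewrite inE.
  by apply/orP; right; rewrite inE.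
- by move=> /orP[]; rewrite inE => Ax; left; split => //; [left|right].
- rewrite reflK sE => -[[x1 Ax]|[x1 [Ax Ax']]].
    have sx0 : side x = 0 by move: x1 x0; lra.
    by move: Ax; rewrite side_eq0// => -[] Ax; apply/andP; rewrite !inE.
  by apply/andP; rewrite !inE.
- move=> /andP[]; rewrite !inE reflK sE => Ax Ax'.
  have [sx0|] := leP (- side x) 0; first by left; split => //; left.
  by right.
Qed.

Lemma polarize_pos A x : 0 <= side x ->
  ((x \in polarize A) = (x \in A) && (refl x \in A)) *
  ((refl x \in polarize A) = (x \in A) || (refl x \in A)).
Proof.
move=> x0; have x1 : side (refl x) <= 0 by rewrite side_refl oppr_le0.
have := polarize_neg A x1; rewrite reflK => -[-> ->].
by rewrite andbC orbC.
Qed.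

Lemma measurable_polarize A : measurable A -> measurable (polarize A).
Proof.
move=> mA; have mr := measurable_refl c w k.
have mrA := preimage_measurable mr mA.
have ms := measurable_side c w k.
rewrite (_ : polarize A =
    (side @^-1` `]-oo, 0]%classic `&` (A `|` refl @^-1` A)) `|`
    (side @^-1` `]0, +oo[%classic `&` (A `&` refl @^-1` A))).
  apply: measurableU; apply: measurableI.
  - by apply: preimage_measurable => //; exact: measurable_itv.
  - exact: measurableU.
  - by apply: preimage_measurable => //; exact: measurable_itv.
  - exact: measurableI.
by congr (_ `|` _); apply/seteqP; split => x; rewrite /= in_itv/= ?andbT.
Qed.

Lemma polarize_sub_ball A r : 0 <= k -> 0 <= r ->
  A `<=` eclosed_ball c r -> polarize A `<=` eclosed_ball c r.
Proof.
move=> k0 r0; rewrite eclosed_ballE// => Ar x [[x0 [/Ar//|]]|[_ [/Ar//]]].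
by move=> /Ar/=; apply: le_trans; exact: sqn_refl_center.
Qed.

Lemma lebesgue_polarize A : measurable A -> L (polarize A) = L A.
Proof.
move=> mA; have mp := measurable_polarize mA.
rewrite !lebesgue_rV_indic//.
have key x : \1_(polarize A) x + \1_(polarize A) (refl x) =
    \1_A x + \1_A (refl x) :> R.
  rewrite !indicE; have [x0|/ltW x0] := leP (side x) 0.
    have [-> ->] := polarize_neg A x0.
    by case: (x \in A); case: (refl x \in A); rewrite /= ?addr0 ?add0r.
  have [-> ->] := polarize_pos A x0.
  by case: (x \in A); case: (refl x \in A); rewrite /= ?addr0 ?add0r.
apply/eqP; rewrite eq_le; apply/andP; split;
  apply: (le_integral_symmetrize (preserving_refl c w k)) => //;
  by [move=> x; rewrite lee_fin
     |apply/measurable_EFinP; exact: measurable_indic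
     |move=> x; rewrite -!EFinD key].
Qed.

(** For a pair of mirror points, if the point on the side of the centre lies in
    [B \ A] and the other one in [A \ B], then polarization removes the latter and
    adds the former; for no pair does the number of points in [A \ B] increase. *)
Lemma lebesgue_polarize_setD A r : 0 <= k -> 0 <= r -> measurable A ->
  (L (polarize A `\` eclosed_ball c r) +
   L ((eclosed_ball c r `\` A) `&` (refl @^-1` (A `\` eclosed_ball c r))) <=
   L (A `\` eclosed_ball c r))%E.
Proof.
move=> k0 r0 mA; set B := eclosed_ball c r; have mp := measurable_polarize mA.
have mB : measurable B by exact: measurable_eclosed_ball.
have mAB : measurable (A `\` B) by exact: measurableD.
have mG : measurable ((B `\` A) `&` (refl @^-1` (A `\` B))).
  apply: measurableI; first exact: measurableD.
  by apply: preimage_measurable => //; exact: measurable_refl.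
have mpB : measurable (polarize A `\` B) by exact: measurableD.
rewrite (lebesgue_rV_indic mAB) (lebesgue_rV_indic mG).
rewrite (lebesgue_rV_indic mpB).
have mi (X : set V) : measurable X -> measurable_fun setT (EFin \o (\1_X : V -> R)).
  by move=> mX; apply/measurable_EFinP; exact: measurable_indic.
rewrite -ge0_integralD//; [|exact: mi|exact: mi].
apply: (le_integral_symmetrize (preserving_refl c w k)) => //.
- by apply: emeasurable_funD; exact: mi.
- exact: mi.
- by move=> x; rewrite -EFinD lee_fin addr_ge0.
move=> x; rewrite -!EFinD lee_fin !indicE.
have rB : side x <= 0 -> refl x \in B -> x \in B.
  rewrite /B eclosed_ballE// => x0; rewrite !inE/=; apply: le_trans.
  exact: sqn_refl_center.
have rB' : 0 <= side x -> x \in B -> refl x \in B.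
  move=> x0; rewrite /B eclosed_ballE// !inE/= => xB; apply: le_trans xB.
  rewrite -[X in _ <= sqn (X - c)](reflK c w k x); apply: sqn_refl_center => //.
  by rewrite side_refl oppr_le0.
have pE y : (y \in refl @^-1` (A `\` B)) = (refl y \in A) && (refl y \notin B).
  by apply/idP/idP; rewrite inE /preimage /= -in_setD ?inE.
rewrite !(in_setD, in_setI, pE, reflK).
have [x0|/ltW x0] := leP (side x) 0.
  move: (rB x0); have [-> ->] := polarize_neg A x0.
  by case: (x \in A); case: (refl x \in A); case: (x \in B);
    case: (refl x \in B) => //= H; rewrite ?(H erefl)//=; lra.
move: (rB' x0); have [-> ->] := polarize_pos A x0.
by case: (x \in A); case: (refl x \in A); case: (x \in B);
  case: (refl x \in B) => //= H; rewrite ?(H erefl)//=; lra.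
Qed.

(** Symmetrize in both variables: for two pairs of mirror points, only two
    values of the kernel occur, the larger one belonging to points on the same
    side. Polarization groups the points of [A] on the same side. *)
Lemma riesz_polarize (f : R -> R) (A : set V) :
  measurable_fun setT f -> (forall t, 0 <= f t) ->
  (forall s t, 0 <= s -> s <= t -> f t <= f s) ->
  measurable A -> (riesz f A <= riesz f (polarize A))%E.
Proof.
move=> mf f0 fd mA; have mp := measurable_polarize mA.
have Pr := preserving_refl c w k.
have Pid : preserving L (@id V) by split; [exact: measurable_id|].
pose t1 (p : V * V) : V * V := (refl p.1, p.2).
pose t2 (p : V * V) : V * V := (p.1, refl p.2).
have P1 : preserving (L \x L)%E t1 := preserving_pair Pr Pid.
have P2 : preserving (L \x L)%E t2 := preserving_pair Pid Pr.
pose h (X : set V) (p : V * V) := (\1_X p.1 * \1_X p.2 * f (enorm (p.1 - p.2)))%:E.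
have mh X : measurable X -> measurable_fun setT (h X).
  by move=> mX; exact: measurable_riesz.
have h0 X p : (0 <= h X p)%E by rewrite lee_fin !mulr_ge0.
have mht X : measurable X -> measurable_fun setT (fun p => h X p + h X (t1 p))%E.
  move=> mX; apply: emeasurable_funD; first exact: mh.
  apply: (measurableT_comp (mh X mX)); exact: (proj1 P1).
apply: lee_double; rewrite -!(integral_symmetrize P1); try exact: h0; try exact: mh.
apply: (le_integral_symmetrize P2) => //; try exact: mht.
- by move=> p; apply: adde_ge0; exact: h0.
- by move=> p; apply: adde_ge0; exact: h0.
move=> -[x y]; rewrite /h /t1 /t2 /= -!EFinD lee_fin !indicE.
have e1 : enorm (refl x - refl y) = enorm (x - y).
  by rewrite !enormE sqn_refl_refl.
have e2 : enorm (refl x - y) = enorm (x - refl y).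
  by rewrite !enormE -(sqn_refl_refl c w k) reflK.
rewrite e1 e2.
have dE := sqn_refl c w k x y.
have f1 : 0 <= side x * side y -> f (enorm (x - refl y)) <= f (enorm (x - y)).
  move=> s0; apply: fd; first exact: enorm_ge0.
  by rewrite enorm_le_sqn dE lerDl divr_ge0// sqn_ge0.
have f2 : side x * side y <= 0 -> f (enorm (x - y)) <= f (enorm (x - refl y)).
  move=> s0; apply: fd; first exact: enorm_ge0.
  by rewrite enorm_le_sqn dE gerDl mulr_le0_ge0// invr_ge0 sqn_ge0.
move: f1 f2; move: (f _) (f _) => u v f1 f2.
have [x0|/ltW x0] := leP (side x) 0; have [y0|/ltW y0] := leP (side y) 0.
- have {f1 f2} uv : v <= u by apply: f1; rewrite mulr_le0.
  have [-> ->] := polarize_neg A x0; have [-> ->] := polarize_neg A y0.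
  by case: (x \in A); case: (refl x \in A); case: (y \in A);
    case: (refl y \in A) => /=; lra.
- have {f1 f2} uv : u <= v by apply: f2; rewrite mulr_le0_ge0.
  have [-> ->] := polarize_neg A x0; have [-> ->] := polarize_pos A y0.
  by case: (x \in A); case: (refl x \in A); case: (y \in A);
    case: (refl y \in A) => /=; lra.
- have {f1 f2} uv : u <= v by apply: f2; rewrite mulr_ge0_le0.
  have [-> ->] := polarize_pos A x0; have [-> ->] := polarize_neg A y0.
  by case: (x \in A); case: (refl x \in A); case: (y \in A);
    case: (refl y \in A) => /=; lra.
- have {f1 f2} uv : v <= u by apply: f1; rewrite mulr_ge0.
  have [-> ->] := polarize_pos A x0; have [-> ->] := polarize_pos A y0.
  by case: (x \in A); case: (refl x \in A); case: (y \in A);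
    case: (refl y \in A) => /=; lra.
Qed.

End polarization.

(** * Reflections with a large overlap *)

Section integral_bounds.
Context d (T : measurableType d) (R : realType).
Variables (m : {measure set T -> \bar R}) (f : T -> \bar R).
Hypotheses (mf : measurable_fun setT f) (f0 : forall x, (0 <= f x)%E).

Lemma integral_cst_indic (M : R) (E : set T) : 0 <= M -> measurable E ->
  (\int[m]_x (M%:E * (\1_E x)%:E) = M%:E * m E)%E.
Proof.
move=> M0 mE; rewrite ge0_integralZl//.
- by rewrite integral_indic// setIT.
- by apply/measurable_EFinP; exact: measurable_indic.
Qed.

Lemma measurable_cst_indic (M : R) (E : set T) : measurable E ->
  measurable_fun setT (fun x => M%:E * (\1_E x)%:E)%E.
Proof.
move=> mE; apply: emeasurable_funM; first exact: measurable_cst.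
by apply/measurable_EFinP; exact: measurable_indic.
Qed.

Lemma integral_le_cst_indic (M : R) (E : set T) : 0 <= M -> measurable E ->
  (forall x, f x <= M%:E * (\1_E x)%:E)%E -> (\int[m]_x f x <= M%:E * m E)%E.
Proof.
move=> M0 mE fM; rewrite -integral_cst_indic//; apply: ge0_le_integral => //.
exact: measurable_cst_indic.
Qed.

Lemma integral_ge_cst_indic (M : R) (E : set T) : 0 <= M -> measurable E ->
  (forall x, M%:E * (\1_E x)%:E <= f x)%E -> (M%:E * m E <= \int[m]_x f x)%E.
Proof.
move=> M0 mE fM; rewrite -integral_cst_indic//; apply: ge0_le_integral => //.
- by move=> x _; rewrite -EFinM lee_fin mulr_ge0.
- exact: measurable_cst_indic.
Qed.

End integral_bounds.

Lemma product_measure_ysection d1 d2 (T1 : measurableType d1)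
    (T2 : measurableType d2) (R : realType)
    (m1 : {sigma_finite_measure set T1 -> \bar R})
    (m2 : {sigma_finite_measure set T2 -> \bar R}) (A : set (T1 * T2)) :
  measurable A -> ((m1 \x m2) A = \int[m2]_y m1 (ysection A y))%E.
Proof.
move=> mA.
rewrite (@product_measure_unique _ _ _ _ _ m1 m2 (m1 \x^ m2)%E)// => X Y mX mY.
by rewrite /= product_measure2E.
Qed.

(** The product of two sigma-finite measures, bundled so that it can be a factor
    of a further product. *)
Section product_sigma_finite.
Context d1 d2 (T1 : measurableType d1) (T2 : measurableType d2) (R : realType).
Variables (m1 : {sigma_finite_measure set T1 -> \bar R})
  (m2 : {sigma_finite_measure set T2 -> \bar R}).

Definition product_measure : set (T1 * T2)%type -> \bar R := (m1 \x m2)%E.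

HB.instance Definition _ := Measure.copy product_measure (m1 \x m2)%E.

Let product_measure_sigma_finite : sigma_finite setT product_measure.
Proof.
have /sigma_finiteP[F [TF ndF Foo]] := sigma_finiteT m1.
have /sigma_finiteP[G [TG ndG Goo]] := sigma_finiteT m2.
exists (fun i => F i `*` G i).
  apply/seteqP; split => // -[x y] _.
  have [i _ Fi] : (\bigcup_i F i) x by rewrite -TF.
  have [j _ Gj] : (\bigcup_i G i) y by rewrite -TG.
  exists (maxn i j) => //; split.
    by move: x Fi; exact/subsetPset/ndF/leq_maxl.
  by move: y Gj; exact/subsetPset/ndG/leq_maxr.
move=> i; have [mF Foi] := Foo i; have [mG Goi] := Goo i; split.
  exact: measurableX.
rewrite [product_measure _]product_measure1E//.
by rewrite lte_mul_pinfty// ge0_fin_numE.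
Qed.

HB.instance Definition _ := @Measure_isSigmaFinite.Build _ _ _ product_measure
  product_measure_sigma_finite.

End product_sigma_finite.

Lemma le_exprVn (R : realFieldType) (a b : R) n :
  0 < a -> a <= b -> b ^- n <= a ^- n.
Proof.
move=> a0 ab; have b0 := lt_le_trans a0 ab.
rewrite lef_pV2 ?posrE ?exprn_gt0//.
by apply: lerXn2r; rewrite // nnegrE ltW.
Qed.

Section overlap.
Context {R : realType} {n : nat}.
Local Notation L := (lebesgue_rV R n).
Local Notation lam := (@lebesgue_measure R).
Local Notation V := 'rV[R]_n.
Local Notation mR := (measurableTypeR R).
Variables (c : V) (r : R).
Hypothesis r_ge0 : 0 <= r.
Variables D1 D2 : set V.
Hypotheses (mD1 : measurable D1) (mD2 : measurable D2).
Hypotheses (D1r : D1 `<=` eclosed_ball c r) (D2r : D2 `<=` eclosed_ball c r).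

Definition dilations : set mR := `[1, 2]%classic.

Definition pair_measure : {sigma_finite_measure set (V * mR)%type -> \bar R} :=
  product_measure L lam.

(** Pairs [(z, k)] such that the translation by [k *: w] sends the point [z] of
    [D2] into [D1]. The factor [k] ranges over an interval because the offset of the
    hyperplane will be averaged, for a fixed normal vector [w]. *)
Definition shift_pairs (w : V) : set (V * mR)%type :=
  [set p | D2 p.1 /\ (1 <= p.2 <= 2 /\ D1 (p.1 + p.2 *: w))].

Definition shift_triples : set (V * (V * mR))%type := [set q | shift_pairs q.1 q.2].

Lemma measurable_shift_triples : measurable shift_triples.
Proof.
have m1 : measurable_fun setT (fun q : V * (V * mR) => q.2.1).
  by apply: measurableT_comp.
have m2 : measurable_fun setT (fun q : V * (V * mR) => q.2.2 : mR).
  by apply: measurableT_comp.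
rewrite (_ : shift_triples = (fun q : V * (V * mR) => q.2.1) @^-1` D2 `&`
    ((fun q : V * (V * mR) => q.2.2) @^-1` `[1, 2]%classic `&`
     (fun q : V * (V * mR) => q.2.1 + q.2.2 *: q.1) @^-1` D1)).
  apply: measurableI; first exact: preimage_measurable.
  apply: measurableI.
    by apply: (preimage_measurable m2); exact: measurable_itv.
  apply: preimage_measurable => //; apply: measurable_addrV => //.
  exact: measurable_scalerV.
by apply/seteqP; split => q; rewrite /shift_triples /shift_pairs/= in_itv.
Qed.

Lemma measurable_shift_pairs w : measurable (shift_pairs w).
Proof.
rewrite (_ : shift_pairs w = xsection shift_triples w); first exact: (measurable_xsection _ measurable_shift_triples).
by apply/seteqP; split => p; rewrite /xsection /shift_triples/= inE.
Qed.

Lemma shift_triples_measure : (L \x pair_measure)%E shift_triples = (\int[L]_w pair_measure (shift_pairs w))%E.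
Proof.
apply: eq_integral => w _ /=; congr (product_measure1 _ _ _).
by apply/seteqP; split => p; rewrite /xsection /shift_triples/= inE.
Qed.

Lemma measurable_dilation_cylinder : measurable (D2 `*` dilations).
Proof. exact: (measurableX mD2 (measurable_itv _)). Qed.

Lemma pair_measure_cylinder : pair_measure (D2 `*` dilations) = L D2.
Proof.
transitivity (L D2 * lam dilations)%E.
  exact: (product_measure1E L lam mD2 (measurable_itv _)).
rewrite [X in (_ * X)%E](_ : _ = 1%E); first by rewrite mule1.
apply: etrans (lebesgue_measure_itv _) _; rewrite /= lte_fin ltr1n -EFinB.
by congr EFin; ring.
Qed.

(** For fixed [z] and [k], the vectors [w] with [z + k *: w] in [D1] form a
    translate of [D1] contracted by [k], and [k <= 2]. *)
Lemma shift_triples_ge : ((2 ^- n)%:E * L D1 * L D2 <= (L \x pair_measure)%E shift_triples)%E.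
Proof.
rewrite (product_measure_ysection L pair_measure measurable_shift_triples).
have D1fin := lebesgue_bounded_fin_num mD1 D1r.
have mE := measurable_dilation_cylinder.
suff : ((2 ^- n * fine (L D1))%:E * pair_measure (D2 `*` dilations) <=
    \int[pair_measure]_y L (ysection shift_triples y))%E.
  by rewrite pair_measure_cylinder EFinM fineK.
apply: integral_ge_cst_indic.
- exact: (measurable_fun_ysection _ measurable_shift_triples).
- by rewrite mulr_ge0 ?invr_ge0 ?exprn_ge0 ?fine_ge0.
- exact: mE.
move=> [z k]; rewrite indicE.
have [|_] := boolP ((z, k) \in _); last by rewrite mule0.
rewrite inE/= /dilations/= in_itv/= => -[Dz /andP[k1 k2]]; rewrite mule1.
have k0 : 0 < k by rewrite (lt_le_trans _ k1).
rewrite (_ : ysection shift_triples (z, k) =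
    (fun w : V => k *: w) @^-1` ((fun x : V => x + z) @^-1` D1)); last first.
  apply/seteqP; split => w; rewrite /ysection/= inE /shift_triples /shift_pairs/= addrC.
    by move=> [_ []].
  by move=> Dzk; split; [exact: Dz|split; [rewrite k1|exact: Dzk]].
have [mz Pz] := preserving_shift z.
rewrite (lebesgue_scale k0 (preimage_measurable mz mD1)) (Pz _ mD1).
rewrite EFinM (fineK D1fin); apply: lee_wpmul2r; first exact: measure_ge0.
by rewrite lee_fin; exact: le_exprVn.
Qed.

Lemma shift_pairs_far w : 4 * r ^+ 2 < sqn w -> shift_pairs w = set0.
Proof.
move=> w4; rewrite -subset0 => -[z k] [/= Dz [/andP[k1 _] Dzk]].
have k0 : 0 <= k by rewrite (le_trans _ k1).
have := sqn_le_double (z + k *: w) c z.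
rewrite [z + _ - z]addrAC subrr add0r sqnZ.
move: (D1r Dzk) (D2r Dz); rewrite !eclosed_ballE//= => H1 H2 H.
have : sqn w <= k ^+ 2 * sqn w.
  by rewrite ler_peMl ?sqn_ge0// expr_ge1.
by lra.
Qed.

Lemma shift_pairs_le w : (pair_measure (shift_pairs w) <= L D2)%E.
Proof.
apply: (@le_trans _ _ (pair_measure (D2 `*` dilations))).
  apply: le_measure; rewrite ?inE.
  - exact: measurable_shift_pairs.
  - exact: measurable_dilation_cylinder.
  by move=> [z k] /= [? [? ?]]; rewrite /dilations/= in_itv.
by rewrite pair_measure_cylinder.
Qed.

(** If every [w] with [eps <= |w|] gave few pairs, the total measure of the
    triples would be small: short vectors [w] form a small ball, and vectors longer
    than the diameter give no pair. *)
Lemma shift_pairs_direction_bound (eps eta : R) : 0 < eps -> 0 < eta ->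
  (forall w, eps ^+ 2 <= sqn w -> (pair_measure (shift_pairs w) <= eta%:E)%E) ->
  ((2 ^- n)%:E * L D1 * L D2 <=
   L D2 * L (eclosed_ball 0 eps) + eta%:E * L (eclosed_ball (0 : V) (2 * r)))%E.
Proof.
move=> eps0 eta0 Heta; apply: (le_trans shift_triples_ge); rewrite shift_triples_measure.
have D2fin := lebesgue_bounded_fin_num mD2 D2r.
have mball s : measurable (eclosed_ball (0 : V) s) by exact: measurable_eclosed_ball.
have mi M s := measurable_cst_indic M (mball s).
have mF : measurable_fun setT (fun w => pair_measure (shift_pairs w)).
  rewrite (_ : (fun _ => _) = pair_measure \o xsection shift_triples).
    exact: (measurable_fun_xsection _ measurable_shift_triples).
  apply/funext => w /=; congr (product_measure1 _ _ _).
  by apply/seteqP; split => p; rewrite /xsection /shift_triples/= inE.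
have int_indic M s (M0 : 0 <= M) := integral_cst_indic L M0 (mball s).
pose g (M : R) s (x : V) : \bar R := (M%:E * (\1_(eclosed_ball (0 : V) s) x)%:E)%E.
have g0 (M : R) s x : 0 <= M -> (0 <= g M s x)%E.
  by move=> M0; rewrite /g -EFinM lee_fin mulr_ge0.
have d0 : 0 <= fine (L D2) by rewrite fine_ge0.
have e0 := ltW eta0.
apply: (@le_trans _ _ (\int[L]_x (g (fine (L D2)) eps x + g eta (2 * r)%R x))%E);
    last first.
  rewrite ge0_integralD//; [|by move=> x _; exact: g0|exact: mi|
    by move=> x _; exact: g0|exact: mi].
  by rewrite !int_indic// fineK.
apply: ge0_le_integral => //.
  by apply: emeasurable_funD; exact: mi.
move=> w _; rewrite /g fineK//.
have [w1|w1] := leP (eps ^+ 2) (sqn w).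
  have [w2|w2] := leP (sqn w) (4 * r ^+ 2).
    rewrite [X in (_ <= _ + X)%E](_ : _ = eta%:E).
      by apply: (le_trans (Heta w w1)); rewrite leeDr// mule_ge0// lee_fin.
    rewrite indicE mem_set ?mule1// eclosed_ballE ?mulr_ge0//= subr0.
    by rewrite exprMn (_ : 2 ^+ 2 = 4 :> R)//; ring.
  rewrite (shift_pairs_far w2) measure0.
  by apply: adde_ge0; apply: mule_ge0 => //; rewrite lee_fin.
rewrite [X in (_ <= X + _)%E](_ : _ = L D2).
  apply: (le_trans (shift_pairs_le w)); rewrite leeDl//.
  by apply: mule_ge0 => //; rewrite lee_fin.
by rewrite indicE mem_set ?mule1// eclosed_ballE ?ltW//= subr0 ltW.
Qed.

(** The shear [k |-> k + 2 <z - c, w> / |w|^2] of the pairs [(z, k)] turns the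
    translations along [w] into reflections with normal vector [w]; since
    [eps <= |w|], it moves [k] by a bounded amount. Averaging over [k] then bounds the
    measure of the pairs by the largest overlap of a reflection. *)
Lemma shift_pairs_le_reflections (w : V) (eps g : R) : 0 < eps -> 0 <= g -> eps ^+ 2 <= sqn w ->
  (forall k, L (D2 `&` (refl c w k @^-1` D1)) <= g%:E)%E ->
  (pair_measure (shift_pairs w) <= (g * (2 * (3 + r ^+ 2 / eps ^+ 2)))%:E)%E.
Proof.
move=> eps0 g0 w_eps Hg; set S := 3 + r ^+ 2 / eps ^+ 2.
have S0 : 0 <= S by rewrite addr_ge0// divr_ge0// sqr_ge0.
have w0 : 0 < sqn w by rewrite (lt_le_trans _ w_eps)// exprn_gt0.
pose refl_pairs : set (V * mR)%type :=
  [set p | D2 p.1 /\ (- S <= p.2 <= S /\ D1 (refl c w p.2 p.1))].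
have mrefl : measurable_fun setT (fun p : V * mR => refl c w p.2 p.1).
  apply: measurable_subrV => //; apply: measurable_scalerV; last exact: measurable_cst.
  apply: measurable_funM => //; apply: measurable_funB; apply: measurable_funM => //.
  by apply: measurable_dot => //; exact: measurable_subrV.
have mrefl_pairs : measurable refl_pairs.
  rewrite (_ : refl_pairs = fst @^-1` D2 `&` (snd @^-1` `[- S, S]%classic `&`
     (fun p : V * mR => refl c w p.2 p.1) @^-1` D1)).
    apply: measurableI; first exact: preimage_measurable.
    apply: measurableI; last exact: preimage_measurable.
    by apply: preimage_measurable => //; exact: measurable_itv.
  by apply/seteqP; split => q; rewrite /refl_pairs/= in_itv.
pose s (z : V) (k : mR) : mR := k + 2 * dot (z - c) w / sqn w.
have ms : measurable_fun setT (fun p : V * mR => (p.1, s p.1 p.2)).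
  apply: measurable_fun_pair => //; apply: measurable_funD => //.
  apply: measurable_funM => //; apply: measurable_funM => //.
  by apply: measurable_dot => //; exact: measurable_subrV.
have [_ Ps] := @preserving_shear _ _ _ _ _ L lam s ms
  (fun z => preserving_shift1 _).
apply: (@le_trans _ _ (pair_measure refl_pairs)).
  rewrite -[leRHS](Ps _ mrefl_pairs); apply: le_measure; rewrite ?inE.
  - exact: measurable_shift_pairs.
  - exact: (preimage_measurable ms mrefl_pairs).
  move=> [z k] [/= Dz [/andP[k1 k2] Dzk]]; split => //=; split; last first.
    rewrite (_ : refl _ _ _ _ = z + k *: w)// /refl -scaleNr; congr (_ + _ *: _).
    by rewrite /side /s; field; rewrite gt_eqF.
  have : `|2 * dot (z - c) w / sqn w| <= r ^+ 2 / eps ^+ 2 + 1.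
    rewrite normf_div (gtr0_norm w0) ler_pdivrMr//; apply: (le_trans (dot_le_sqn _ _)).
    rewrite mulrDl mul1r lerD2r.
    move: (D2r Dz); rewrite eclosed_ballE//= => /le_trans; apply.
    rewrite mulrAC ler_pdivlMr ?exprn_gt0// ler_wpM2l ?sqr_ge0//.
  by rewrite /s ler_norml => /andP[d1 d2]; apply/andP; split; rewrite /S; lra.
rewrite [pair_measure _]product_measure_ysection//.
have mSS : measurable `[- S : mR, S]%classic by exact: measurable_itv.
have := @integral_le_cst_indic _ _ _ lam (fun y => L (ysection refl_pairs y))
  (measurable_fun_ysection _ mrefl_pairs) (fun y => measure_ge0 L _) g _ g0 mSS.
rewrite [X in (_ -> _ <= _ * X)%E](_ : _ = (2 * S)%:E); last first.
  apply: etrans (lebesgue_measure_itv _) _; rewrite /= lte_fin.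
  case: ifPn => [_|]; first by rewrite -EFinB; congr EFin; ring.
  by rewrite -leNgt => SS; congr EFin; lra.
rewrite -EFinM; apply => k; rewrite indicE.
have [kS|kS] := boolP (- S <= k <= S).
  rewrite mem_set /= ?in_itv// mule1; apply: le_trans (Hg k).
  apply: le_measure; rewrite ?inE.
  - exact: measurable_ysection.
  - apply: measurableI => //; apply: preimage_measurable mD1.
    exact: measurable_refl.
  - by move=> z; rewrite /ysection/= inE => -[/= ? [_ ?]].
rewrite memNset /= ?in_itv/=; last by apply/negP.
rewrite mule0 (_ : ysection refl_pairs k = set0) ?measure0//.
rewrite -subset0 => z; rewrite /ysection/= inE => -[_ [/=]].
by rewrite (negbTE kS).
Qed.

End overlap.

(** The same hyperplane, with its sides exchanged. *)
Lemma reflN (R : realType) n (c w : 'rV[R]_n) k : refl c (- w) (- k) = refl c w k.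
Proof.
apply/funext => z; rewrite /refl /side sqnN dotNr scalerN -scaleNr.
by congr (_ - _ *: _); rewrite -mulNr; congr (_ / _); ring.
Qed.

(** The ball is contained in a cube of side [2 * e]; the exponent [n] is dropped
    since [2 * e <= 1]. *)
Lemma lebesgue_small_ball (R : realType) n (e : R) : (0 < n)%N ->
  0 <= e -> 2 * e <= 1 ->
  (lebesgue_rV R n (eclosed_ball 0 e) <= (2 * e)%:E)%E.
Proof.
move=> n0 e0 e1; have e20 : 0 <= 2 * e by rewrite mulr_ge0.
apply: (@le_trans _ _ (lebesgue_rV R n (box (0 - const_mx e) (2 * e)))).
  apply: le_measure; rewrite ?inE.
  - exact: measurable_eclosed_ball.
  - exact: measurable_box.
  exact: eclosed_ball_sub_box.
by rewrite lebesgue_box// lee_fin -[leRHS]expr1 ler_wiXn2l.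
Qed.

Section uniform_overlap.
Context {R : realType} {n : nat}.
Hypothesis n_gt0 : (0 < n)%N.
Local Notation L := (lebesgue_rV R n).
Local Notation V := 'rV[R]_n.

(** The volume of [shift_triples] is at least [2^-n * delta^2], so that some
    vector [w] which is not too short gives many translations, hence some
    hyperplane normal to [w] gives a large overlap. All the constants depend only on
    [delta] and on the ball that contains both sets. *)
Lemma reflection_overlap (c : V) (r delta : R) : 0 <= r -> 0 < delta ->
  exists2 g : R, 0 < g & forall D1 D2 : set V,
    measurable D1 -> measurable D2 ->
    D1 `<=` eclosed_ball c r -> D2 `<=` eclosed_ball c r ->
    (delta%:E <= L D1)%E -> (delta%:E <= L D2)%E ->
    exists w k, 0 <= k /\ (g%:E <= L (D2 `&` (refl c w k @^-1` D1)))%E.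
Proof.
move=> r0 delta0.
have mball (x : V) s : measurable (eclosed_ball x s) by exact: measurable_eclosed_ball.
pose vB := fine (L (eclosed_ball c r)); pose vC := fine (L (eclosed_ball (0 : V) (2 * r))).
have vBf : L (eclosed_ball c r) \is a fin_num.
  exact: (lebesgue_bounded_fin_num (mball _ _) (@subset_refl _ _)).
have vCf : L (eclosed_ball (0 : V) (2 * r)) \is a fin_num.
  exact: (lebesgue_bounded_fin_num (mball _ _) (@subset_refl _ _)).
have vB0 : 0 <= vB by rewrite fine_ge0.
have vC0 : 0 <= vC by rewrite fine_ge0.
pose a : R := 2 ^- n * delta * delta.
have a0 : 0 < a by rewrite !mulr_gt0// invr_gt0 exprn_gt0.
(* Both error terms of the bound for short and long vectors are made at most a / 4. *)
pose eps := Num.min (1 / 2) (a / (8 * (vB + 1))).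
have eps0 : 0 < eps.
  by rewrite lt_min divr_gt0//= divr_gt0// mulr_gt0// ltr_wpDl.
have eps1 : 2 * eps <= 1.
  by rewrite -ler_pdivlMl// mulr1 ge_min div1r lexx.
have eps2 : vB * (2 * eps) <= a / 4.
  have : eps <= a / (8 * (vB + 1)) by rewrite ge_min lexx orbT.
  rewrite ler_pdivlMr; last by rewrite mulr_gt0// ltr_wpDl.
  by have := eps0; nra.
pose eta := a / (4 * (vC + 1)).
have eta0 : 0 < eta by rewrite divr_gt0// mulr_gt0// ltr_wpDl.
have eta1 : eta * vC <= a / 4.
  have : eta * (4 * (vC + 1)) = a.
    by rewrite /eta divfK// gt_eqF// mulr_gt0// ltr_wpDl.
  by have := eta0; lra.
(* Length of the range of offsets over which the reflections are averaged. *)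
pose S := 2 * (3 + r ^+ 2 / eps ^+ 2).
have S0 : 0 < S by rewrite mulr_gt0// ltr_wpDr// divr_ge0// sqr_ge0.
exists (eta / (2 * S)); first by rewrite divr_gt0// mulr_gt0.
move=> D1 D2 mD1 mD2 D1r D2r LD1 LD2.
have D1f := lebesgue_bounded_fin_num mD1 D1r.
have D2f := lebesgue_bounded_fin_num mD2 D2r.
have [w [w_eps w_shift]] : exists w, eps ^+ 2 <= sqn w /\
    (eta%:E < pair_measure (shift_pairs D1 D2 w))%E.
  apply: contrapT => H.
  have Hle w : eps ^+ 2 <= sqn w ->
      (pair_measure (shift_pairs D1 D2 w) <= eta%:E)%E.
    by move=> w_eps; rewrite leNgt; apply/negP => ?; apply: H; exists w.
  have := shift_pairs_direction_bound r0 mD1 mD2 D1r D2r eps0 eta0 Hle.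
  apply/negP; rewrite -ltNge.
  apply: (@le_lt_trans _ _ (a / 4 + a / 4)%:E).
    rewrite EFinD; apply: leeD; last first.
      by rewrite -(fineK vCf) -EFinM lee_fin.
    apply: (@le_trans _ _ (vB * (2 * eps))%:E); last by rewrite lee_fin.
    rewrite EFinM fineK//; apply: lee_pmul => //.
      by apply: le_measure; rewrite ?inE.
    by apply: lebesgue_small_ball => //; exact: ltW.
  apply: (@lt_le_trans _ _ a%:E); first by rewrite lte_fin; lra.
  move: LD1 LD2; rewrite -(fineK D1f) -(fineK D2f) -!EFinM !lee_fin => LD1 LD2.
  rewrite /a -!mulrA ler_wpM2l ?invr_ge0 ?exprn_ge0//.
  by apply: ler_pM => //; exact: ltW.
have [k Hk] : exists k,
    ((eta / (2 * S))%:E < L (D2 `&` (refl c w k @^-1` D1)))%E.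
  apply: contrapT => H.
  have Hle k : (L (D2 `&` (refl c w k @^-1` D1)) <= (eta / (2 * S))%:E)%E.
    by rewrite leNgt; apply/negP => ?; apply: H; exists k.
  have g0 : 0 <= eta / (2 * S) by apply: divr_ge0; [exact: ltW|apply: mulr_ge0 => //; exact: ltW].
  have := shift_pairs_le_reflections r0 mD1 mD2 D2r eps0 g0 w_eps Hle.
  apply/negP; rewrite -ltNge; apply: le_lt_trans w_shift.
  have half x y : y != 0 :> R -> x / (2 * y) * y = x / 2 by move=> y0; field.
  rewrite lee_fin -/S half ?gt_eqF//.
  by rewrite ler_pdivrMr// ler_peMr ?ler1n// ltW.
have [k0|/ltW k0] := leP 0 k; first by exists w, k; split => //; exact: ltW.
by exists (- w), (- k); rewrite reflN oppr_ge0; split => //; exact: ltW.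
Qed.

End uniform_overlap.

(** * The rearrangement inequality for bounded kernels *)

Section prod_indic.
Context {R : realType} {n : nat}.
Local Notation L := (lebesgue_rV R n).
Local Notation V := 'rV[R]_n.

Lemma measurable_prod_indic (M : R) (E F : set V) : measurable E -> measurable F ->
  measurable_fun setT (fun p : V * V => (M * (\1_E p.1 * \1_F p.2))%:E).
Proof.
move=> mE mF; apply/measurable_EFinP; apply: measurable_funM => //.
by apply: measurable_funM; apply: measurableT_comp => //; exact: measurable_indic.
Qed.

Lemma integral_prod_indic (M : R) (E F : set V) :
  0 <= M -> measurable E -> measurable F ->
  (\int[L \x L]_p (M * (\1_E p.1 * \1_F p.2))%:E = M%:E * (L E * L F))%E.
Proof.
move=> M0 mE mF; under eq_integral do rewrite EFinM.
rewrite ge0_integralZl//; last first.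
  apply/measurable_EFinP.
  by apply: measurable_funM; apply: measurableT_comp => //; exact: measurable_indic.
congr (_ * _)%E; rewrite -product_measure1E//.
rewrite -[in RHS](setIT (E `*` F)) -integral_indic//; last exact: measurableX.
apply: eq_integral => p _; rewrite !indicE -natrM mulnb; congr (_%:R%:E).
by rewrite in_setX.
Qed.

End prod_indic.

Section bounded_rearrangement.
Context {R : realType} {n : nat}.
Hypothesis n_gt0 : (0 < n)%N.
Local Notation L := (lebesgue_rV R n).
Local Notation V := 'rV[R]_n.
Variables (f : R -> R) (M : R).
Hypotheses (mf : measurable_fun setT f) (f_ge0 : forall t, 0 <= f t)
  (f_noninc : forall s t, 0 <= s -> s <= t -> f t <= f s)
  (f_le : forall t, f t <= M).

Lemma sub_eclosed_ball (c : V) r s : 0 <= r -> r <= s ->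
  eclosed_ball c r `<=` eclosed_ball c s.
Proof. by move=> r0 rs x /= /le_trans; exact. Qed.

(** Both sides are the common volume minus the volume of the intersection. *)
Lemma lebesgue_setD_sym (A B : set V) : measurable A -> measurable B ->
  L A = L B -> L B \is a fin_num -> L (A `\` B) = L (B `\` A).
Proof.
move=> mA mB AB Bf; have Boo : (L B < +oo)%E by rewrite ltey_eq Bf.
have Aoo : (L A < +oo)%E by rewrite AB.
apply: etrans (measureD mA mB Aoo) _; apply: etrans _ (esym (measureD mB mA Boo)).
by rewrite setIC; congr (_ - _)%E; exact: AB.
Qed.

Section iteration.
Variables (c : V) (r s : R) (A : set V).
Hypotheses (r_ge0 : 0 <= r) (rs : r <= s) (mA : measurable A)
  (As : A `<=` eclosed_ball c s) (A_volume : L A = L (eclosed_ball c r)).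

Let admissible (X : set V) :=
  [/\ measurable X, X `<=` eclosed_ball c s, L X = L A &
      (riesz f A <= riesz f X)%E].

(** Otherwise every admissible set [X] could be polarized into another one with
    [vol (X \ B)] decreased by the fixed amount given by [reflection_overlap], and
    that volume would become negative. *)
Lemma exists_admissible (delta : R) : 0 < delta -> exists X : set V,
  [/\ measurable X, X `<=` eclosed_ball c s, L X = L A,
      (riesz f A <= riesz f X)%E & (L (X `\` eclosed_ball c r) < delta%:E)%E].
Proof.
move=> delta0; set B := eclosed_ball c r.
have mB : measurable B by exact: measurable_eclosed_ball.
have Bs : B `<=` eclosed_ball c s by exact: sub_eclosed_ball.
have Bf : L B \is a fin_num := lebesgue_bounded_fin_num mB Bs.
have s0 : 0 <= s := le_trans r_ge0 rs.
have [g g0 Hg] := reflection_overlap n_gt0 c s0 delta0.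
apply: contrapT => H.
have far X : admissible X -> (delta%:E <= L (X `\` B))%E.
  by move=> [? ? ? ?]; rewrite leNgt; apply/negP => ?; apply: H; exists X.
have step X : admissible X -> exists2 Y, admissible Y &
    (L (Y `\` B) + g%:E <= L (X `\` B))%E.
  move=> aX; have [mX Xs XA XE] := aX.
  have XB : L (X `\` B) = L (B `\` X).
    by apply: lebesgue_setD_sym => //; rewrite XA.
  have mXB : measurable (X `\` B) by exact: measurableD.
  have mBX : measurable (B `\` X) by exact: measurableD.
  have [||||w [k [k0 Hw]]] := Hg (X `\` B) (B `\` X) mXB mBX.
  - by move=> x [/Xs].
  - by move=> x [/Bs].
  - exact: far.
  - by rewrite -XB; exact: far.
  exists (polarize c w k X).
    split.
    - exact: measurable_polarize.
    - exact: polarize_sub_ball.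
    - by rewrite lebesgue_polarize.
    - by apply: (le_trans XE); exact: riesz_polarize.
  have := lebesgue_polarize_setD c w k0 r_ge0 mX.
  apply: le_trans; exact: leeD2l.
have iter N : exists2 Y, admissible Y &
    (L (Y `\` B) + (g *+ N)%:E <= L (A `\` B))%E.
  elim: N => [|N [Y aY HY]].
    by exists A; [split|rewrite mulr0n adde0].
  have [Z aZ HZ] := step Y aY; exists Z => //.
  apply: le_trans HY; rewrite mulrS EFinD addeA.
  by rewrite leeD2r.
have mAB : measurable (A `\` B) by exact: measurableD.
have ABf : L (A `\` B) \is a fin_num.
  by apply: (lebesgue_bounded_fin_num mAB (c := c) (r := s)) => x [/As].
have [Y _] := iter (Num.bound (fine (L (A `\` B)) / g)).
apply/negP; rewrite -ltNge -(fineK ABf).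
apply: (@lt_le_trans _ _ (g *+ Num.bound (fine (L (A `\` B)) / g))%:E).
  rewrite lte_fin -[ltRHS]mulr_natl -ltr_pdivrMr//.
  by apply: archi_boundP; rewrite divr_ge0 ?fine_ge0// ltW.
by rewrite leeDr.
Qed.

End iteration.

(** A pair in [X * X] outside [B * B] has a coordinate in [X \ B]. *)
Lemma riesz_le_setD (X B : set V) : measurable X -> measurable B -> 
  (riesz f X <= riesz f B + (M%:E * (L (X `\` B) * L X) + M%:E * (L X * L (X `\` B))))%E.
Proof.
move=> mX mB; have mXB : measurable (X `\` B) by exact: measurableD.
have M0 : 0 <= M := le_trans (f_ge0 0) (f_le 0).
have mi (E F : set V) : measurable E -> measurable F ->
    measurable_fun setT (fun p : V * V => (M * (\1_E p.1 * \1_F p.2))%:E).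
  by move=> mE mF; exact: measurable_prod_indic.
rewrite -!integral_prod_indic//.
have mr := measurable_riesz mf.
rewrite -ge0_integralD//; [|by move=> p _; rewrite lee_fin !mulr_ge0
  |exact: mi|by move=> p _; rewrite lee_fin !mulr_ge0|exact: mi].
rewrite -ge0_integralD//; [|by move=> p _; rewrite lee_fin !mulr_ge0
  |exact: mr|by move=> p _; rewrite -EFinD lee_fin addr_ge0// !mulr_ge0
  |by apply: emeasurable_funD; exact: mi].
apply: ge0_le_integral => //.
- by move=> p _; rewrite lee_fin !mulr_ge0.
- exact: mr.
- by apply: emeasurable_funD; [exact: mr|apply: emeasurable_funD; exact: mi].
move=> [x y] _; rewrite -!EFinD lee_fin /= !indicE !in_setD.
have := f_ge0 (enorm (x - y)); have := f_le (enorm (x - y)).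
move: (f _) => t tM t0.
by case: (x \in X); case: (y \in X); case: (x \in B); case: (y \in B) => /=; lra.
Qed.

(** Polarize [A] until it exceeds the ball by a set of small volume, whose
    contribution to the energy is small. *)
Theorem riesz_le_eclosed_ball (c : V) (r : R) (A : set V) (s : R) :
  0 <= r -> r <= s -> measurable A -> A `<=` eclosed_ball c s ->
  L A = L (eclosed_ball c r) ->
  (riesz f A <= riesz f (eclosed_ball c r))%E.
Proof.
move=> r0 rs mA As AB; set B := eclosed_ball c r.
have mB : measurable B by exact: measurable_eclosed_ball.
have M0 : 0 <= M := le_trans (f_ge0 0) (f_le 0).
have Af := lebesgue_bounded_fin_num mA As.
apply/lee_addgt0Pr => e e0.
pose v := fine (L A).
have v0 : 0 <= v by rewrite fine_ge0.
(* The excess delta costs at most 2 M v delta in energy. *)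
pose delta := e / (2 * (M * v + 1)).
have D0 : 0 < 2 * (M * v + 1) by rewrite mulr_gt0// ltr_wpDl// mulr_ge0.
have delta0 : 0 < delta by rewrite divr_gt0.
have [X [mX Xs XA XE Xd]] := exists_admissible r0 rs mA As AB delta0.
apply: (le_trans XE); apply: (le_trans (riesz_le_setD mX mB)).
rewrite leeD2l// XA (muleC (L A)) -(fineK Af) -/v.
have mXB : measurable (X `\` B) by exact: measurableD.
have XBf : L (X `\` B) \is a fin_num.
  by apply: (lebesgue_bounded_fin_num mXB (c := c) (r := s)) => x [/Xs].
move: Xd; rewrite -/B -(fineK XBf) lte_fin => Xd.
rewrite -!EFinM -EFinD lee_fin.
have : delta * (2 * (M * v + 1)) = e by rewrite /delta divfK// gt_eqF.
have := mulr_ge0 M0 v0; have : 0 <= fine (L (X `\` B)) by rewrite fine_ge0.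
move: (fine _) Xd => u Xd u0 Mv0 de.
have : (M * v) * u <= (M * v) * delta by rewrite ler_wpM2l// ltW.
have := delta0; nra.
Qed.

End bounded_rearrangement.

(** * Riesz energies *)

Section bodies_are_bounded.
Context {R : realType} {n : nat}.
Local Notation V := 'rV[R]_n.

Lemma coord_le_norm (x : V) i : `|x ord0 i| <= `|x|.
Proof.
rewrite [leRHS]/Num.Def.normr/= mx_normrE; apply: le_trans (le_bigmax _ _ (ord0, i)).
exact: lexx.
Qed.

Lemma compact_measurable_rV (A : set V) : compact A -> measurable A.
Proof.
move=> cA; rewrite -(setCK A); apply: measurableC; apply: open_measurable_rV.
by apply: closed_openC; apply: compact_closed cA; exact: norm_hausdorff.
Qed.

Lemma compact_sub_eclosed_ball (A : set V) (c : V) : compact A ->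
  exists2 s, 0 <= s & A `<=` eclosed_ball c s.
Proof.
move=> /compact_bounded[M [_ HM]].
pose K := Num.max (M + 1) 0.
have K0 : 0 <= K by rewrite le_max lexx orbT.
have KA x : A x -> `|x| <= K.
  have M1 : M < M + 1 by rewrite ltrDl.
  by move=> Ax; rewrite le_max (HM _ M1 _ Ax).
pose s := Num.sqrt (2 * (n%:R * K ^+ 2 + sqn c)).
have s2 : 0 <= 2 * (n%:R * K ^+ 2 + sqn c).
  by rewrite mulr_ge0// addr_ge0 ?sqn_ge0// mulr_ge0// sqr_ge0.
exists s; first exact: sqrtr_ge0.
move=> x Ax; rewrite eclosed_ballE ?sqrtr_ge0//= sqr_sqrtr//.
have := sqn_le_double x 0 c; rewrite !subr0 => /le_trans; apply.
rewrite ler_wpM2l// lerD2r /sqn /dot.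
apply: (@le_trans _ _ (\sum_(i < n) K ^+ 2)).
  apply: ler_sum => i _; rewrite -expr2 -real_normK ?num_real//.
  rewrite ler_pXn2r ?nnegrE//; apply: le_trans (KA _ Ax); exact: coord_le_norm.
by rewrite sumr_const card_ord -[_ *+ n]mulr_natl.
Qed.

End bodies_are_bounded.

Section energy.
Context {R : realType} {n : nat}.
Hypothesis n_gt0 : (0 < n)%N.
Local Notation L := (lebesgue_rV R n).
Local Notation V := 'rV[R]_n.

Lemma riesz_energyE (alpha : R) (A : set V) :
  riesz_energy alpha A = riesz (@powR R ^~ (alpha - n%:R)) A.
Proof.
rewrite /riesz_energy integral_mkcond; apply: eq_integral => -[x y] _.
rewrite patchE; have [|] := boolP ((x, y) \in A `*` A);
  by rewrite in_setX /= !indicE => /[1!andbC]; case: (x \in A); case: (y \in A) => //=;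
     rewrite ?mul1r ?mul0r.
Qed.

(** A point is contained in arbitrarily small cubes. *)
Lemma lebesgue_point (x : V) : L [set x] = 0%E.
Proof.
apply/eqP; rewrite eq_le measure_ge0 andbT; apply/lee_addgt0Pr => e e0.
rewrite add0e; pose d := Num.min e 1.
have d0 : 0 < d by rewrite lt_min e0 ltr01.
have d1 : d <= 1 by rewrite ge_min lexx orbT.
have box1 : [set x] `<=` box x d by move=> _ -> i; rewrite lexx lerDl ltW.
have mx : measurable [set x].
  by apply: compact_measurable_rV; exact: compact_set1.
apply: (@le_trans _ _ (L (box x d))).
  by apply: le_measure; rewrite ?inE//; exact: measurable_box.
rewrite (lebesgue_box x (ltW d0)) lee_fin; apply: (@le_trans _ _ (d ^+ 1)).
  by apply: ler_wiXn2l; rewrite // ltW.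
by rewrite expr1 ge_min lexx.
Qed.

Lemma diagonal_null :
  measurable [set p : V * V | p.1 = p.2] /\ (L \x L)%E [set p : V * V | p.1 = p.2] = 0%E.
Proof.
have mD : measurable [set p : V * V | p.1 = p.2].
  rewrite (_ : mkset _ = (fun p : V * V => enorm (p.1 - p.2)) @^-1` [set 0]).
    apply: preimage_measurable; last exact: measurable_set1.
    by apply: measurable_enorm; exact: measurable_subrV.
  apply/seteqP; split => p /=.
    by move=> ->; rewrite subrr enormE sqn0 sqrtr0.
  by move=> /enorm_eq0/eqP; rewrite subr_eq0 => /eqP.
split => //; rewrite /product_measure1 integral0_eq// => x _ /=.
rewrite (_ : xsection _ _ = [set x]) ?lebesgue_point//.
by apply/seteqP; split => y; rewrite /xsection/= inE/= => ->.
Qed.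

Lemma ge0_riesz f (A : set V) : (forall t, 0 <= f t) -> (0 <= riesz f A)%E.
Proof. by move=> f0; apply: integral_ge0 => p _; rewrite lee_fin !mulr_ge0. Qed.

Lemma powR_nonincreasing (b s t : R) : b <= 0 -> 0 < s -> s <= t -> t `^ b <= s `^ b.
Proof.
move=> b0 s0 st.
have powRE x : x `^ b = (x `^ (- b))^-1 by rewrite powRN invrK.
rewrite (powRE t) (powRE s).
have t0 := lt_le_trans s0 st.
rewrite lef_pV2 ?posrE ?powR_gt0//.
by apply: ge0_ler_powR; rewrite ?oppr_ge0 ?nnegrE// ltW.
Qed.

(** Replacing distances below [1 / k.+1] by [1 / k.+1] keeps the kernel
    nonincreasing and makes it bounded and positive at distance zero. *)
Definition truncated_powR (b : R) (k : nat) (t : R) : R :=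
  (Num.max t k.+1%:R^-1) `^ b.

Lemma measurable_truncated_powR b k : measurable_fun setT (truncated_powR b k).
Proof.
apply: (measurableT_comp (measurable_powR b)).
by apply: measurable_maxr => //; exact: measurable_id.
Qed.

Lemma truncated_powR_nonincreasing b k s t : b <= 0 -> s <= t ->
  truncated_powR b k t <= truncated_powR b k s.
Proof.
move=> b0 st; apply: powR_nonincreasing => //.
  by rewrite lt_max invr_gt0 ltr0n orbT.
by rewrite ge_max !le_max st lexx !orbT.
Qed.

Lemma truncated_powR_le b k t : b <= 0 -> truncated_powR b k t <= k.+1%:R^-1 `^ b.
Proof.
move=> b0; apply: powR_nonincreasing => //.
by rewrite le_max lexx orbT.
Qed.

Lemma truncated_powR_nondecreasing b t : b <= 0 ->
  {homo (truncated_powR b)^~ t : j k / (j <= k)%N >-> j <= k}.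
Proof.
move=> b0 j k jk; apply: powR_nonincreasing => //.
  by rewrite lt_max invr_gt0 ltr0n orbT.
rewrite ge_max !le_max lexx/=; apply/orP; right.
by rewrite lef_pV2 ?posrE// ler_nat.
Qed.

Lemma truncated_powR_le_powR b k t : b <= 0 -> 0 < t -> truncated_powR b k t <= t `^ b.
Proof.
by move=> b0 t0; apply: powR_nonincreasing => //; rewrite le_max lexx.
Qed.

(** Monotone convergence along the truncations. *)
Lemma riesz_powR_le_sup b (A : set V) (C : \bar R) : b < 0 -> measurable A ->
  (forall k, riesz (truncated_powR b k) A <= C)%E -> (riesz (@powR R ^~ b) A <= C)%E.
Proof.
move=> b0 mA HC.
pose g k (p : V * V) := (\1_A p.1 * \1_A p.2 * truncated_powR b k (enorm (p.1 - p.2)))%:E.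
have mg k : measurable_fun setT (g k).
  exact: (measurable_riesz (measurable_truncated_powR _ _) mA mA).
have g0 k p : (0 <= g k p)%E by rewrite lee_fin !mulr_ge0// powR_ge0.
have ndg p : {homo g^~ p : j k / (j <= k)%N >-> (j <= k)%E}.
  move=> j k jk; rewrite lee_fin ler_wpM2l ?mulr_ge0//.
  exact: (truncated_powR_nondecreasing _ (ltW b0) jk).
have cg p : cvgn (g^~ p) by apply: ereal_nondecreasing_is_cvgn; exact: ndg.
have limgE : (\int[L \x L]_p limn (g^~ p) = limn (fun k => \int[L \x L]_p g k p))%E.
  by apply: monotone_convergence => //; move=> p _; exact: ndg.
have mlim : measurable_fun setT (fun p => limn (g^~ p)).
  by apply: (emeasurable_fun_cvg g) => // p _; exact: cg.
apply: (@le_trans _ _ (\int[L \x L]_p limn (g^~ p))%E).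
  apply: ge0_le_integral => //.
  - by move=> p _; rewrite lee_fin !mulr_ge0// powR_ge0.
  - exact: (measurable_riesz (measurable_powR b) mA mA).
  move=> [x y] _.
  have gle k : (g k (x, y) <= limn (g^~ (x, y)))%E.
    rewrite (cvg_lim _ (ereal_nondecreasing_cvgn (ndg (x, y))))//.
    by apply: ereal_sup_ubound; exists k.
  have [xy0|xy0] := eqVneq (enorm (x - y)) 0.
    by rewrite /= xy0 powR0 ?lt_eqF// mulr0; apply: le_trans (gle 0%N).
  have {}xy0 : 0 < enorm (x - y) by rewrite lt_def xy0 enorm_ge0.
  pose k := Num.bound (enorm (x - y))^-1.
  apply: le_trans (gle k); rewrite lee_fin ler_wpM2l ?mulr_ge0//=.
  rewrite /truncated_powR max_l//.
  rewrite invf_ple ?posrE//; apply: ltW.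
  apply: lt_trans (archi_boundP _) _; first by rewrite invr_ge0 ltW.
  by rewrite ltr_nat.
rewrite limgE; apply: lime_le; last by apply: nearW => k; exact: HC.
apply: ereal_nondecreasing_is_cvgn => j k jk; apply: ge0_le_integral => //.
by move=> p _; exact: ndg.
Qed.

(** Off the diagonal, the truncation is below the kernel. *)
Lemma riesz_truncated_powR_le b k (A : set V) : b <= 0 -> measurable A ->
  (riesz (truncated_powR b k) A <= riesz (@powR R ^~ b) A)%E.
Proof.
move=> b0 mA; have [mD D0] := diagonal_null.
apply: ae_ge0_le_integral => //.
- by move=> p _; rewrite lee_fin !mulr_ge0// powR_ge0.
- exact: (measurable_riesz (measurable_truncated_powR _ _) mA mA).
- by move=> p _; rewrite lee_fin !mulr_ge0// powR_ge0.
- exact: (measurable_riesz (measurable_powR b) mA mA).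
exists [set p : V * V | p.1 = p.2]; split => //= -[x y] /= H.
apply: contrapT => xy; apply: H => _.
rewrite lee_fin ler_wpM2l ?mulr_ge0//; apply: truncated_powR_le_powR => //.
by apply: enorm_gt0; rewrite subr_eq0; apply/eqP.
Qed.

Theorem riesz_energy_le_ball (alpha : R) (c : V) (r s : R) (A : set V) :
  alpha < n%:R -> 0 <= r -> r <= s -> measurable A -> A `<=` eclosed_ball c s ->
  L A = L (eclosed_ball c r) ->
  (riesz_energy alpha A <= riesz_energy alpha (eclosed_ball c r))%E.
Proof.
move=> an r0 rs mA As AB; rewrite !riesz_energyE.
have b0 : alpha - n%:R < 0 by rewrite subr_lt0.
apply: riesz_powR_le_sup => // k.
apply: (@le_trans _ _ (riesz (truncated_powR (alpha - n%:R) k) (eclosed_ball c r))).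
  apply: (@riesz_le_eclosed_ball _ _ n_gt0 _ (k.+1%:R^-1 `^ (alpha - n%:R))
    _ _ _ _ c r A s) => //.
  - exact: measurable_truncated_powR.
  - by move=> t; exact: powR_ge0.
  - by move=> t u _; exact: (truncated_powR_nonincreasing _ (ltW b0)).
  - by move=> t; exact: (truncated_powR_le _ _ (ltW b0)).
apply: riesz_truncated_powR_le; first exact: ltW.
exact: measurable_eclosed_ball.
Qed.

(** Cutting at [0] makes the kernel nonnegative; on a set of diameter at most
    [d] the cut is not reached. *)
Definition powR_gap (d b t : R) : R := Num.max 0 (d `^ b - t `^ b).

Lemma measurable_powR_gap d b : measurable_fun setT (powR_gap d b).
Proof.
apply: measurable_maxr; first exact: measurable_cst.
apply: measurable_funB; [exact: measurable_cst|exact: (measurable_powR b)].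
Qed.

Lemma riesz_add_complement (b d s : R) (c : V) (A : set V) :
  0 <= b -> 0 <= s -> d = 2 * s -> measurable A -> A `<=` eclosed_ball c s ->
  (riesz (powR_gap d b) A + riesz (@powR R ^~ b) A =
   (d `^ b)%:E * (L A * L A))%E.
Proof.
move=> b0 s0 dE mA As; have mf := measurable_powR_gap d b.
rewrite -integral_prod_indic ?powR_ge0// -ge0_integralD//.
- apply: eq_integral => -[x y] _; rewrite -EFinD -mulrDr /= mulrC !indicE.
  have [xA|xA] := boolP (x \in A); last by rewrite !mul0r !mulr0.
  have [yA|yA] := boolP (y \in A); last by rewrite !mulr0.
  congr ((_ * _)%:E); rewrite /powR_gap max_r ?subrK// subr_ge0.
  apply: ge0_ler_powR; rewrite ?nnegrE ?enorm_ge0 ?dE ?mulr_ge0//.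
  rewrite enorm_le ?mulr_ge0//; apply: (le_trans (sqn_le_double x c y)).
  move: xA yA; rewrite !inE => /As + /As; rewrite !eclosed_ballE//=; nra.
- by move=> p _; rewrite lee_fin !mulr_ge0// le_max lexx.
- exact: (measurable_riesz mf mA mA).
- by move=> p _; rewrite lee_fin !mulr_ge0// powR_ge0.
- exact: (measurable_riesz (measurable_powR b) mA mA).
Qed.

Theorem riesz_energy_ge_ball (alpha : R) (c : V) (r s : R) (A : set V) :
  n%:R < alpha -> 0 <= r -> r <= s -> measurable A -> A `<=` eclosed_ball c s ->
  L A = L (eclosed_ball c r) ->
  (riesz_energy alpha (eclosed_ball c r) <= riesz_energy alpha A)%E.
Proof.
move=> an r0 rs mA As AB; rewrite !riesz_energyE; set B := eclosed_ball c r.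
have mB : measurable B by exact: measurable_eclosed_ball.
have Bs : B `<=` eclosed_ball c s by exact: sub_eclosed_ball.
have b0 : 0 <= alpha - n%:R by rewrite subr_ge0 ltW.
have s0 := le_trans r0 rs.
set b := alpha - n%:R; pose d := 2 * s.
pose f := powR_gap d b.
have f0 t : 0 <= f t by rewrite /f /powR_gap le_max lexx.
have EA : (riesz f A + riesz (@powR R ^~ b) A = (d `^ b)%:E * (L A * L A))%E.
  exact: riesz_add_complement As.
have EB : (riesz f B + riesz (@powR R ^~ b) B = (d `^ b)%:E * (L B * L B))%E.
  exact: riesz_add_complement Bs.
have fAB : (riesz f A <= riesz f B)%E.
  apply: (@riesz_le_eclosed_ball _ _ n_gt0 _ (d `^ b) _ _ _ _ c r A s) => //.
  - exact: measurable_powR_gap.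
  - move=> t u t0 tu; rewrite /f /powR_gap ge_max !le_max lexx/=; apply/orP; right.
    by rewrite lerD2l lerN2 ge0_ler_powR ?nnegrE// (le_trans t0).
  - by move=> t; rewrite /f /powR_gap ge_max powR_ge0 gerBl powR_ge0.
have Bf := lebesgue_bounded_fin_num mB Bs.
have fBf : riesz f B \is a fin_num.
  rewrite ge0_fin_numE ?ge0_riesz//.
  apply: (@le_lt_trans _ _ ((d `^ b)%:E * (L B * L B))%E).
    by rewrite -EB leeDl// ge0_riesz// => t; exact: powR_ge0.
  by rewrite -(fineK Bf) -!EFinM ltry.
rewrite -(leeD2lE _ _ fBf) EB -AB -EA.
by rewrite leeD2r.
Qed.

End energy.

(** * Topology of closed balls *)

Section ball_topology.
Context {R : realType} {n : nat}.
Local Notation V := 'rV[R]_n.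

Lemma continuous_enorm (c : V) : continuous (fun x : V => enorm (x - c)).
Proof.
have csq i : continuous (fun x : V => (x - c) ord0 i * (x - c) ord0 i).
  have cc : continuous (fun x : V => (x - c) ord0 i).
    rewrite (_ : (fun _ => _) = (fun x : V => x ord0 i - c ord0 i)).
      move=> x; exact: (cvgB (@coord_continuous R 1 n ord0 i x) (cvg_cst _)).
    by apply/funext => x; rewrite !mxE.
  by move=> x; exact: (cvgM (cc x) (cc x)).
have csum : continuous (fun x : V => sqn (x - c)).
  by apply: continuous_big => //; exact: add_continuous.
rewrite (_ : (fun _ => _) = Num.sqrt \o (fun x : V => sqn (x - c))).
  by move=> x; apply: continuous_comp; [exact: csum|exact: sqrt_continuous].
by apply/funext => x; rewrite enormE.
Qed.

Lemma closed_eclosed_ball (c : V) r : closed (eclosed_ball c r).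
Proof.
rewrite (_ : eclosed_ball c r = (fun x => enorm (x - c)) @^-1` [set t | t <= r])//.
apply: closed_comp; last exact: closed_le.
by move=> x _; exact: continuous_enorm.
Qed.

Lemma open_eball (c : V) r : open [set x | enorm (x - c) < r].
Proof.
rewrite (_ : mkset _ = (fun x => enorm (x - c)) @^-1` [set t | t < r])//.
by apply: open_comp; [move=> x _; exact: continuous_enorm|exact: open_lt].
Qed.

Lemma compact_eclosed_ball (c : V) r : 0 <= r -> compact (eclosed_ball c r).
Proof.
move=> r0; set a := c - const_mx r.
apply: (@subclosed_compact _ _ (box a (2 * r)));
  [exact: closed_eclosed_ball| |exact: eclosed_ball_sub_box].
rewrite (_ : box a _ =
  [set x | forall i, `[a ord0 i, a ord0 i + 2 * r]%classic (x ord0 i)]).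
  apply: (@rV_compact R n (fun i => `[a ord0 i, a ord0 i + 2 * r]%classic)) => i.
  exact: segment_compact.
by apply/seteqP; split => x H i; have := H i; rewrite /= in_itv.
Qed.

(** Stated for both directions: outward for the interior of a ball, inward for
    the closure of its interior. *)
Lemma nbhs_radial (x y : V) (A : set V) : nbhs x A ->
  exists2 t : R, 0 < t <= 1 & A (x + t *: y) /\ A (x - t *: y).
Proof.
move=> /nbhs_normP[e /= e0 eA].
have y1 : 0 < `|y| + 1 by rewrite ltr_wpDl.
pose t := Num.min 1 (e / (2 * (`|y| + 1))).
have t0 : 0 < t by rewrite lt_min ltr01 divr_gt0// mulr_gt0.
have ty : `|t *: y| < e.
  rewrite normrZ gtr0_norm//; apply: (@le_lt_trans _ _ (e / (2 * (`|y| + 1)) * `|y|)).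
    by rewrite ler_wpM2r// ge_min lexx orbT.
  rewrite mulrAC ltr_pdivrMr ?mulr_gt0// ltr_pM2l//.
  by have := normr_ge0 y; lra.
exists t; first by rewrite t0 ge_min lexx.
split; apply: eA => /=.
  by rewrite opprD addrA subrr sub0r normrN.
by rewrite opprB addrC addrNK.
Qed.

(** A point at distance [r] is not interior, as it can be moved outward. *)
Lemma interior_eclosed_ball (c : V) r : 0 < r ->
  (eclosed_ball c r)° = [set x | enorm (x - c) < r].
Proof.
move=> r0; apply/seteqP; split => x.
  move=> nx; have Ax : enorm (x - c) <= r := nbhs_singleton nx.
  rewrite /= lt_neqAle Ax andbT; apply/eqP => xr.
  have [t /andP[t0 t1] [H _]] := nbhs_radial (x - c) nx.
  move: H; rewrite /eclosed_ball/= addrAC -{1}(scale1r (x - c)) -scalerDl enormZ.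
  rewrite xr gtr0_norm ?addr_gt0// -[leRHS]mul1r ler_pM2r//.
  by rewrite gerDl leNgt t0.
move=> xr; have ox := @open_eball c r.
by apply: filterS (open_nbhs_nbhs (conj ox xr)) => y /ltW.
Qed.

Lemma closure_interior_eclosed_ball (c : V) r : 0 < r ->
  closure (eclosed_ball c r)° = eclosed_ball c r.
Proof.
move=> r0; apply/seteqP; split.
  have /closure_id E := @closed_eclosed_ball c r; rewrite [X in _ `<=` X]E.
  exact: closure_subset (@interior_subset _ _).
move=> x xr A /(nbhs_radial (x - c))[t /andP[t0 t1] [_ At]].
exists (x - t *: (x - c)); split=> //.
rewrite interior_eclosed_ball//= addrAC -{1}(scale1r (x - c)) -scalerBl enormZ.
rewrite ger0_norm ?subr_ge0//; apply: (@le_lt_trans _ _ ((1 - t) * r)).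
  by rewrite ler_wpM2l// subr_ge0.
by rewrite gtr_pMl// gtrBl.
Qed.

Lemma frontier_eclosed_ball (c : V) r : 0 < r ->
  frontier (eclosed_ball c r) = [set x | enorm (x - c) = r].
Proof.
move=> r0; rewrite /frontier interior_eclosed_ball//.
have /closure_id <- := @closed_eclosed_ball c r.
apply/seteqP; split => x; rewrite /eclosed_ball/=.
  by move=> [xr /negP]; rewrite -leNgt => rx; apply/eqP; rewrite eq_le xr.
by move=> ->; rewrite ltxx lexx; split.
Qed.

End ball_topology.

(** * Continuously differentiable maps *)

Section C1.
Context {R : realType} {k : nat}.
Local Notation V := 'rV[R]_k.
Implicit Types (F G : V -> R) (u v w : V).

(** Continuity of all directional derivatives; it passes to sums, products and
    powers, which gives continuity of the Jacobian of the patches without computing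
    it. *)
Definition C1_scalar F :=
  forall u, differentiable F u /\ forall v, {for u, continuous (fun w => 'd F w v)}.

Lemma C1_scalar_cst (a : R) : C1_scalar (fun=> a).
Proof.
move=> u; split; first exact: differentiable_cst.
move=> v; rewrite (_ : (fun _ => _) = fun=> 0); first exact: (@cst_continuous V R 0 u).
by apply/funext => w; exact: (congr1 (fun h : V -> R => h v) (diff_cst a w)).
Qed.

Lemma diff_coord (W : V) i u : 'd (fun x : V => x ord0 i : R) W u = u ord0 i.
Proof.
have lin : linear (fun x : V => x ord0 i : R) by move=> a x y; rewrite !mxE.
pose fM := GRing.isLinear.Build _ _ _ _ _ lin.
pose f : {linear _ -> _} := HB.pack (fun x : V => x ord0 i : R) fM.
have -> : 'd (fun x : V => x ord0 i : R) W = f :> (V -> R).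
  by apply: (@diff_lin _ _ _ f); exact: coord_continuous.
by [].
Qed.

Lemma C1_scalar_coord i : C1_scalar (fun u => u ord0 i).
Proof.
move=> u; split; first exact: differentiable_coord.
move=> v; rewrite (_ : (fun _ => _) = fun=> v ord0 i); first exact: (@cst_continuous V R (v ord0 i) u).
by apply/funext => w; rewrite diff_coord.
Qed.

Lemma C1_scalarD F G : C1_scalar F -> C1_scalar G -> C1_scalar (fun u => F u + G u).
Proof.
move=> HF HG u; have [dF cF] := HF u; have [dG cG] := HG u.
split; first exact: differentiableD.
move=> v; rewrite (_ : (fun _ => _) = fun w => 'd F w v + 'd G w v).
  exact: (cvgD (cF v) (cG v)).
apply/funext => w; have [dFw _] := HF w; have [dGw _] := HG w.
by rewrite -[(fun u => F u + G u)]/(F + G) (diffD dFw dGw).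
Qed.

Lemma C1_scalarM F G : C1_scalar F -> C1_scalar G -> C1_scalar (fun u => F u * G u).
Proof.
move=> HF HG u; have [dF cF] := HF u; have [dG cG] := HG u.
split; first exact: differentiableM.
move=> v; rewrite (_ : (fun _ => _) = fun w => F w * 'd G w v + G w * 'd F w v).
  have cFu := differentiable_continuous dF; have cGu := differentiable_continuous dG.
  exact: (cvgD (cvgM cFu (cG v)) (cvgM cGu (cF v))).
apply/funext => w; have [dFw _] := HF w; have [dGw _] := HG w.
by rewrite -[(fun u => F u * G u)]/(F * G) (diffM dFw dGw).
Qed.

Lemma C1_scalar_sum n (F : 'I_n -> V -> R) : (forall i, C1_scalar (F i)) ->
  C1_scalar (fun u => \sum_(i < n) F i u).
Proof.
elim: n F => [|n IHn] F HF.
  rewrite (_ : (fun _ => _) = fun=> 0); first exact: C1_scalar_cst.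
  by apply/funext => u; rewrite big_ord0.
rewrite (_ : (fun _ => _) =
  fun u => F ord0 u + \sum_(i < n) F (lift ord0 i) u).
  by apply: C1_scalarD => //; apply: IHn.
by apply/funext => u; rewrite big_ord_recl.
Qed.

Lemma differentiable_powR (p x : R) : 0 < x -> differentiable (@powR R ^~ p) x.
Proof.
by move=> x0; apply/derivable1_diffP; apply: derivable_powR; rewrite in_itv/= x0.
Qed.

Lemma C1_scalar_powR F p : C1_scalar F -> (forall u, 0 < F u) ->
  C1_scalar (fun u => F u `^ p).
Proof.
move=> HF F0 u; have [dF cF] := HF u.
have dpow q w : differentiable F w -> differentiable (fun w => F w `^ q) w.
  by move=> dFw; exact: (differentiable_comp dFw (differentiable_powR q (F0 w))).
split; first exact: dpow.
move=> v; rewrite (_ : (fun _ => _) = fun w => 'd F w v * (p * F w `^ (p - 1))).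
  have cp := differentiable_continuous (dpow (p - 1) u dF).
  exact: (cvgM (cF v) (cvgM (cvg_cst _) cp)).
apply/funext => w; have [dFw _] := HF w.
rewrite -[(fun u => F u `^ p)]/((@powR R ^~ p) \o F).
rewrite (diff_comp dFw (differentiable_powR p (F0 w)))/=.
rewrite (diff1E (differentiable_powR p (F0 w)))/= powR_derive1//.
by rewrite in_itv/= F0.
Qed.

End C1.

Section jacobian.
Context {R : realType} {k n : nat}.
Variable f : 'rV[R]_k -> 'rV[R]_n.

Lemma differentiable_row u :
  (forall i, differentiable (fun x => f x ord0 i) u) -> differentiable f u.
Proof.
move=> df; rewrite (_ : f = \sum_(i < n) (fun x => f x ord0 i *: delta_mx ord0 i)).
  by apply: differentiable_sum => i; exact: differentiableZl.
by apply/funext => x; rewrite fct_sumE {1}[f x]row_sum_delta.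
Qed.

Lemma diff_row u v i : differentiable f u ->
  ('d f u v) ord0 i = 'd (fun x => f x ord0 i) u v.
Proof.
move=> df; rewrite -[(fun x => f x ord0 i)]/((fun y : 'rV[R]_n => y ord0 i) \o f).
rewrite (diff_comp df (@differentiable_coord _ 1 n (f u) ord0 i))/=.
by rewrite diff_coord.
Qed.

Lemma C1_jacobian : (forall i, C1_scalar (fun x => f x ord0 i)) ->
  forall u, differentiable f u /\ {for u, continuous (jacobian f)}.
Proof.
move=> Hf; have df u : differentiable f u.
  by apply: differentiable_row => i; have [] := Hf i u.
move=> u; split => //; apply/(cvg_ballP (FF := nbhs_filter u)) => e e0.
have jacE w i j : jacobian f w i j = 'd (fun x => f x ord0 j) w (delta_mx ord0 i).
  by rewrite mxE diff_row.
have near_ij (i : 'I_k) (j : 'I_n) : \forall w \near u,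
    ball (jacobian f u i j : R) e (jacobian f w i j).
  have [_ /(_ (delta_mx ord0 i)) cj] := Hf j u.
  move/(cvg_ballP (FF := nbhs_filter u)): cj => /(_ e e0); apply: filterS => w.
  move=> H; apply: (eq_ind_r (fun x : R => ball x e _) _ (jacE u i j)).
  exact: (eq_ind_r (fun y : R => ball _ e y) H (jacE w i j)).
have := @filter_forall _ ('I_k * 'I_n)%type
  (fun ij w => ball (jacobian f u ij.1 ij.2 : R) e (jacobian f w ij.1 ij.2))
  (nbhs u) (nbhs_filter u) (fun ij => near_ij ij.1 ij.2).
by apply: filterS => w H; split => // i j; exact: (H (i, j)).
Qed.

End jacobian.

(** Chain rule: the Jacobian of the left inverse is a right inverse matrix. *)
Lemma row_free_jacobian (R : realType) k n (f : 'rV[R]_k -> 'rV[R]_n)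
    (g : 'rV[R]_n -> 'rV[R]_k) u :
  cancel f g -> differentiable f u -> differentiable g (f u) ->
  row_free (jacobian f u).
Proof.
move=> fK df dg; apply/row_freeP; exists (jacobian g (f u)).
apply/row_matrixP => i; rewrite row_mul rowE /jacobian !mul_rV_lin1 rowE mulmx1.
have /(congr1 (fun h => h (delta_mx 0 i))) := diff_comp df dg; rewrite /= => <-.
rewrite (_ : g \o f = id); last by apply/funext.
have idE : 'd (@id 'rV[R]_k) u = id :> ('rV[R]_k -> 'rV[R]_k) by rewrite diff_val.
exact: (congr1 (fun h => h (delta_mx 0 i)) idE).
Qed.

(** * Closed balls are bodies *)

Section sphere_patches.
Context {R : realType} {k : nat}.
Local Notation U := 'rV[R]_k.
Local Notation V := 'rV[R]_k.+1.
Variables (c : V) (r : R).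
Hypothesis r_gt0 : 0 < r.
Implicit Types (i : 'I_k.+1) (b : bool) (u : U).

(** The face [x_i = (-1)^b] of the cube of side 2 centred at the origin,
    parametrized by the unit cube. *)
Definition cube_face i b u : V :=
  \row_j (if unlift i j is Some j' then 2 * u ord0 j' - 1 else (-1) ^+ b).

(** Central projection of the face to the sphere. The inverse of the norm is
    written as a power of the squared norm, which is differentiable where it is
    positive. *)
Definition sphere_patch i b u : V :=
  c + (r * sqn (cube_face i b u) `^ (- 2^-1)) *: cube_face i b u.

(** A left inverse: ratios of coordinates of [y - c] are invariant under central
    projection. *)
Definition sphere_patch_inv i b (y : V) : U :=
  \row_j (((-1) ^+ b * ((y - c) ord0 (lift i j) / (y - c) ord0 i) + 1) / 2).

Lemma cube_face_diag i b u : cube_face i b u ord0 i = (-1) ^+ b.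
Proof. by rewrite mxE unlift_none. Qed.

Lemma cube_face_lift i b u j : cube_face i b u ord0 (lift i j) = 2 * u ord0 j - 1.
Proof. by rewrite mxE liftK. Qed.

Lemma sqn_cube_face_gt0 i b u : 0 < sqn (cube_face i b u).
Proof.
apply: lt_le_trans (sqr_coord_le_sqn _ i).
by rewrite cube_face_diag sqrr_sign ltr01.
Qed.

Definition patch_scale i b u : R := r * sqn (cube_face i b u) `^ (- 2^-1).

Lemma patch_scaleE i b u : patch_scale i b u = r / enorm (cube_face i b u).
Proof. by rewrite /patch_scale powRN powR12_sqrt ?sqn_ge0// enormE. Qed.

Lemma patch_scale_gt0 i b u : 0 < patch_scale i b u.
Proof. by rewrite mulr_gt0// powR_gt0// sqn_cube_face_gt0. Qed.

Lemma sphere_patch_sub i b u :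
  sphere_patch i b u - c = patch_scale i b u *: cube_face i b u.
Proof. by rewrite /sphere_patch addrAC subrr add0r. Qed.

Lemma sphere_patch_coord i b u j :
  (sphere_patch i b u - c) ord0 j = patch_scale i b u * cube_face i b u ord0 j.
Proof. by rewrite sphere_patch_sub mxE. Qed.

Lemma enorm_sphere_patch i b u : enorm (sphere_patch i b u - c) = r.
Proof.
rewrite sphere_patch_sub enormZ gtr0_norm ?patch_scale_gt0// patch_scaleE divfK//.
rewrite gt_eqF// enorm_gt0//; apply/eqP => f0.
by have := sqn_cube_face_gt0 i b u; rewrite f0 sqn0 ltxx.
Qed.

Lemma sphere_patchK i b : cancel (sphere_patch i b) (sphere_patch_inv i b).
Proof.
move=> u; apply/rowP => j; rewrite mxE !sphere_patch_coord cube_face_lift cube_face_diag.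
have := patch_scale_gt0 i b u; move: (patch_scale _ _ _) => t t0.
rewrite -mulf_div divff ?gt_eqF// mul1r mulrCA divff ?signr_eq0// mulr1.
by rewrite subrK mulrAC divff ?mul1r.
Qed.

Lemma C1_cube_face i b j : C1_scalar (fun u => cube_face i b u ord0 j).
Proof.
have [j' ->|->] := unliftP i j.
  rewrite (_ : (fun _ => _) = fun u : U => 2 * u ord0 j' + -1).
    apply: C1_scalarD; last exact: C1_scalar_cst.
    by apply: C1_scalarM; [exact: C1_scalar_cst|exact: C1_scalar_coord].
  by apply/funext => u; rewrite cube_face_lift.
rewrite (_ : (fun _ => _) = fun=> (-1) ^+ b); first exact: C1_scalar_cst.
by apply/funext => u; rewrite cube_face_diag.
Qed.

Lemma C1_sphere_patch i b j : C1_scalar (fun u => sphere_patch i b u ord0 j).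
Proof.
rewrite (_ : (fun _ => _) = fun u => c ord0 j +
  (r * (\sum_l cube_face i b u ord0 l * cube_face i b u ord0 l) `^ (- 2^-1)) *
  cube_face i b u ord0 j); last first.
  by apply/funext => u; rewrite !mxE.
apply: C1_scalarD; first exact: C1_scalar_cst.
apply: C1_scalarM; last exact: C1_cube_face.
apply: C1_scalarM; first exact: C1_scalar_cst.
apply: C1_scalar_powR; last by move=> u; exact: (sqn_cube_face_gt0 i b u).
by apply: C1_scalar_sum => l; apply: C1_scalarM; exact: C1_cube_face.
Qed.

Lemma differentiable_sphere_patch_inv i b y : (y - c) ord0 i != 0 ->
  differentiable (sphere_patch_inv i b) y.
Proof.
move=> yi; apply: differentiable_row => j.
have dc l : differentiable (fun y : V => (y - c) ord0 l : R) y.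
  rewrite (_ : (fun _ => _) =
      (fun y : V => y ord0 l : R) + (cst (- c ord0 l))).
    apply: differentiableD; last exact: differentiable_cst.
    exact: (@differentiable_coord _ 1 k.+1 y ord0 l).
  by apply/funext => x; rewrite !mxE.
rewrite (_ : (fun _ => _) =
  (cst ((-1) ^+ b) * ((fun y : V => (y - c) ord0 (lift i j) : R) *
    (fun y : V => ((y - c) ord0 i)^-1)) + cst 1) * cst 2^-1).
  apply: differentiableM; last exact: differentiable_cst.
  apply: differentiableD; last exact: differentiable_cst.
  apply: differentiableM; first exact: differentiable_cst.
  by apply: differentiableM => //; exact: differentiableV.
by apply/funext => x; rewrite mxE.
Qed.

Lemma sphere_patch_C1_patch i b : C1_patch (n := k.+1) (sphere_patch i b).
Proof.
have C1p := C1_jacobian (C1_sphere_patch i b).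
split.
- by exists setT; [split; [exact: openT|]|move=> u _; exact: C1p].
- move=> u v _ _ uv; rewrite -[u](sphere_patchK i b) -[v](sphere_patchK i b).
  by congr sphere_patch_inv.
- move=> u _; apply: (row_free_jacobian (sphere_patchK i b)).
    by have [] := C1p u.
  apply: differentiable_sphere_patch_inv.
  rewrite sphere_patch_coord cube_face_diag mulf_neq0 ?signr_eq0//.
  by rewrite gt_eqF// patch_scale_gt0.
Qed.

(** The ray from [c] to [x] meets the face that belongs to a coordinate of
    [x - c] of maximal absolute value. *)
Lemma sphere_covered (x : V) : enorm (x - c) = r ->
  exists i b, (sphere_patch i b @` closed_cube (n := k)) x.
Proof.
move=> xr; set y := x - c.
have [i _ Hi] := @arg_maxP _ _ _ ord0 xpredT (fun i => `|y ord0 i|) isT.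
have yi_max j : `|y ord0 j| <= `|y ord0 i| := Hi j isT.
have y0 : y != 0.
  by apply/eqP => y0; move: xr r_gt0; rewrite -/y y0 enormE sqn0 sqrtr0 => <-; rewrite ltxx.
have Myi : 0 < `|y ord0 i|.
  rewrite normr_gt0; apply: contra y0 => /eqP yi0; apply/eqP/rowP => j.
  by rewrite [RHS]mxE; apply/eqP; have := yi_max j; rewrite yi0 normr0 normr_le0.
set M := `|y ord0 i|; pose b := y ord0 i < 0.
have sM : y ord0 i = M * (-1) ^+ b by rewrite mulrC /M /b -realEsign ?num_real.
exists i, b; exists (\row_j ((y ord0 (lift i j) / M + 1) / 2)) => [j|].
  rewrite mxE; have := yi_max (lift i j); rewrite -/M => yM.
  have : `|y ord0 (lift i j) / M| <= 1.
    by rewrite normf_div (ger0_norm (ltW Myi)) ler_pdivrMr// mul1r.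
  by rewrite ler_norml => /andP[? ?]; apply/andP; split; lra.
set u := \row_j _.
have fE : cube_face i b u = M^-1 *: y.
  apply/rowP => j; have [j' ->|->] := unliftP i j.
    by rewrite cube_face_lift !mxE; field; rewrite gt_eqF.
  by rewrite cube_face_diag mxE sM mulKf// gt_eqF.
apply: (addIr (- c)); rewrite sphere_patch_sub patch_scaleE fE enormZ.
rewrite gtr0_norm ?invr_gt0// -/y xr scalerA.
by rewrite -[RHS]scale1r; congr (_ *: _); field; rewrite !gt_eqF.
Qed.

(** On the interior of a face exactly one coordinate has maximal absolute value,
    and its index and sign determine the face; both are invariant under central
    projection. *)
Lemma open_patches_disjoint i b i' b' u v : (i, b) != (i', b') ->
  open_cube u -> open_cube v -> sphere_patch i b u <> sphere_patch i' b' v.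
Proof.
move=> neq Hu Hv E.
have Ec j : patch_scale i b u * cube_face i b u ord0 j =
    patch_scale i' b' v * cube_face i' b' v ord0 j.
  by rewrite -!sphere_patch_coord E.
have := patch_scale_gt0 i b u; have := patch_scale_gt0 i' b' v.
move: (patch_scale i b u) (patch_scale i' b' v) Ec => s t Ec t0 s0.
have small (w : U) j : open_cube w -> `|2 * w ord0 j - 1| < 1.
  by move=> /(_ j)/andP[w0 w1]; rewrite ltr_norml; apply/andP; split; lra.
have [ii|ii] := eqVneq i i'.
  move: neq (Ec i); rewrite ii xpair_eqE eqxx/= !cube_face_diag => bb.
  by case: b b' bb {Ec Hu Hv E} => -[] //= _; rewrite !expr0 !expr1; lra.
have [j ij] : exists j, i' = lift i j by case: (unliftP i i') ii => [j ->|->]; [exists j|rewrite eqxx].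
have [j' ij'] : exists j, i = lift i' j.
  by move: ii; rewrite eq_sym; case: (unliftP i' i) => [l ->|->]; [exists l|rewrite eqxx].
have st : t < s.
  have := congr1 Num.norm (Ec i'); rewrite {1}ij cube_face_lift cube_face_diag.
  rewrite !normrM normr_sign mulr1 (gtr0_norm s0) (gtr0_norm t0) => <-.
  by rewrite gtr_pMr// small.
have ts : s < t.
  have := congr1 Num.norm (Ec i); rewrite {3}ij' cube_face_lift cube_face_diag.
  rewrite !normrM normr_sign mulr1 (gtr0_norm s0) (gtr0_norm t0) => ->.
  by rewrite gtr_pMr// small.
by have := lt_trans st ts; rewrite ltxx.
Qed.

Theorem eclosed_ball_body : body (eclosed_ball c r).
Proof.
split; [exact/compact_eclosed_ball/ltW|exact: closure_interior_eclosed_ball|].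
pose I := ('I_k.+1 * bool)%type.
exists #|{: I}|, (fun j => let p := enum_val j in sphere_patch p.1 p.2); split.
- by move=> j; exact: sphere_patch_C1_patch.
- rewrite frontier_eclosed_ball//; apply/seteqP; split => x /=.
    move=> /sphere_covered[i [b Hx]]; exists (enum_rank (i, b)) => //.
    by rewrite enum_rankK.
  by move=> [j _ [u _ <-]]; exact: enorm_sphere_patch.
- move=> j j' jj'; rewrite -subset0 => x [[u Hu <-] [v Hv /esym]].
  apply: open_patches_disjoint => //; rewrite -!surjective_pairing.
  by rewrite (inj_eq enum_val_inj).
Qed.

End sphere_patches.

(** * Balls of prescribed volume *)

Lemma lebesgue_eclosed_ball (R : realType) n (c : 'rV[R]_n) (r : R) : 0 < r ->
  lebesgue_rV R n (eclosed_ball c r) =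
  ((r ^+ n)%:E * lebesgue_rV R n (eclosed_ball 0 1))%E.
Proof.
move=> r0; have mB := measurable_eclosed_ball (0 : 'rV[R]_n) 1.
have [_ Pc] := preserving_shift (- c).
have rV0 : 0 < r^-1 by rewrite invr_gt0.
have ms : measurable_fun setT (fun x : 'rV[R]_n => r^-1 *: x).
  by apply: measurable_scalerV => //; exact: measurable_id.
have := lebesgue_scale rV0 mB; rewrite exprVn invrK => <-.
rewrite -(Pc _ (preimage_measurable ms mB)); congr (lebesgue_rV R n _).
apply/seteqP; split => x; rewrite /eclosed_ball/= subr0 enormZ gtr0_norm//;
  by rewrite ler_pdivrMl// mulr1.
Qed.

(** The volume of a ball is the [n]-th power of its radius, up to a constant. *)
Lemma exists_ball_of_volume (R : realType) n (c : 'rV[R]_n) (v : R) :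
  (0 < n)%N -> 0 < v ->
  exists2 r, 0 < r & lebesgue_rV R n (eclosed_ball c r) = v%:E.
Proof.
move=> n0 v0; pose w := fine (lebesgue_rV R n (eclosed_ball 0 1)).
have wE : lebesgue_rV R n (eclosed_ball 0 1) = w%:E.
  rewrite fineK//; exact: (lebesgue_bounded_fin_num (measurable_eclosed_ball _ _)
    (@subset_refl _ _)).
have w0 : 0 < w.
  by rewrite -lte_fin -wE; exact: lebesgue_eclosed_ball_gt0.
have vw0 : 0 < v / w by rewrite divr_gt0.
have nR : n%:R != 0 :> R by rewrite pnatr_eq0 -lt0n.
exists ((v / w) `^ n%:R^-1); first exact: powR_gt0.
rewrite lebesgue_eclosed_ball ?powR_gt0// wE -EFinM; congr EFin.
by rewrite -powR_mulrn ?powR_ge0// -powRrM mulVf// powRr1 ?divfK ?gt_eqF// ltW.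
Qed.

Theorem proposition3p8 (R : realType) (m : nat) (m_ge2 : (2 <= m)%N)
    (alpha : R) (alpha_gt0 : 0 < alpha) (v : R) (v_gt0 : 0 < v) :
  (exists (c : 'rV[R]_m) (r : R),
    0 < r /\ lebesgue_rV R m (eclosed_ball c r) = v%:E) /\
  forall (c : 'rV[R]_m) (r : R),
    0 < r -> lebesgue_rV R m (eclosed_ball c r) = v%:E ->
    (alpha < m%:R ->
      attains_max (bodies_of_volume v%:E) (riesz_energy alpha)
        (eclosed_ball c r)) /\
    (m%:R < alpha ->
      attains_min (bodies_of_volume v%:E) (riesz_energy alpha)
        (eclosed_ball c r)).
Proof.
have m_gt0 : (0 < m)%N := ltnW m_ge2.
split.
  have [r r0 Lr] := exists_ball_of_volume (0 : 'rV[R]_m) m_gt0 v_gt0.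
  by exists 0, r.
move=> c r r0 Lr.
have ball_body : bodies_of_volume v%:E (eclosed_ball c r).
  split=> //; case: m m_ge2 m_gt0 c Lr => // k _ _ c _.
  exact: eclosed_ball_body.
have bounded A : bodies_of_volume v%:E A -> exists2 s, r <= s &
    [/\ measurable A, A `<=` eclosed_ball c s &
        lebesgue_rV R m A = lebesgue_rV R m (eclosed_ball c r)].
  move=> [[cA _ _] LA]; have [s s0 As] := compact_sub_eclosed_ball c cA.
  exists (Num.max s r); first by rewrite le_max lexx orbT.
  split; [exact: compact_measurable_rV| |by rewrite LA].
  by apply: (subset_trans As); apply: sub_eclosed_ball; rewrite // le_max lexx.
split=> alpha_m; split=> // A /bounded[s rs [mA As LA]].
- exact: (riesz_energy_le_ball m_gt0 alpha_m (ltW r0) rs mA As LA).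
- exact: (riesz_energy_ge_ball m_gt0 alpha_m (ltW r0) rs mA As LA).
Qed.
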